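(* Let $\mathscr{A}$ be a $C^*$-algebra and let $\mathscr{M}$ be a full Hilbert $C^*$-module over $\mathscr{A}$. Then the following condition [H] holds for $\mathscr{M}$ if and only if $\mathscr{A}$ is a finite dimensional $C^*$-algebra: [H] For each norm-bounded sequence $(x_n)$ in $\mathscr{M}$, there exist a subsequence $(x_{n_k})$ of $(x_n)$ and an element $x_0\in\mathscr{M}$ such that, for every $y\in\mathscr{M}$, the sequence $(\langle x_{n_k},y\rangle)_k$ converges to $\langle x_0,y\rangle$ in the norm of $\mathscr{A}$.
   Context: All $C^*$-algebras are complex and are not assumed to be unital. Let $\mathscr{A}$ be a $C^*$-algebra. A pre-Hilbert $\mathscr{A}$-module is a complex linear space $\mathscr{M}$ that is an algebraic left $\mathscr{A}$-module with $\lambda(ax)=a(\lambda x)=(\lambda a)x$ for $x\in\mathscr{M}$, $a\in\mathscr{A}$, $\lambda\in\mathbb{C}$, together with a mapping $\langle\cdot,\cdot\rangle:\mathscr{M}\times\mathscr{M}\to\mathscr{A}$ such that for all $x,y,z\in\mathscr{M}$, $a\in\mathscr{A}$, $\lambda\in\mathbb{C}$: (i) $\langle \lambda x+y,z\rangle=\lambda\langle x,z\rangle+\langle y,z\rangle$; (ii) $\langle ax,y\rangle=a\langle x,y\rangle$; (iii) $\langle x,y\rangle^*=\langle y,x\rangle$; (iv) $\langle x,x\rangle\ge 0$; (v) $\langle x,x\rangle=0$ if and only if $x=0$. The norm on $\mathscr{M}$ is $\|x\|_{\mathscr{M}}=\sqrt{\|\langle x,x\rangle\|_{\mathscr{A}}}$.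 A Hilbert $C^*$-module over $\mathscr{A}$ (Hilbert $\mathscr{A}$-module) is a pre-Hilbert $\mathscr{A}$-module that is complete with respect to this norm. It is called full if the linear subspace of $\mathscr{A}$ generated by $\{\langle x,y\rangle : x,y\in\mathscr{M}\}$ is dense in $\mathscr{A}$. *)

(* Defs.v *)
From HB Require Import structures.
From mathcomp Require Import all_boot all_order all_algebra.
From mathcomp Require Import complex.
From mathcomp Require Import all_classical all_reals all_analysis.

Set Implicit Arguments.
Unset Strict Implicit.
Unset Printing Implicit Defensive.

Import Order.TTheory GRing.Theory Num.Theory.
Import numFieldNormedType.Exports.

Local Open Scope classical_set_scope.
Local Open Scope ring_scope.

(* The complex numbers are R[i] for R : realType.  Norms take values in R[i],
   whose partial order satisfies 0 <= z iff z is real and nonnegative.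
   MathComp's ring structures have a unit, so the product of a possibly
   non-unital C*-algebra is a separate operation amul. *)
HB.mixin Record NormedModule_isCStarAlg (R : realType) A
    of CompleteNormedModule R[i] A := {
  amul : A -> A -> A;
  astar : A -> A;
  amulA : forall a b c, amul a (amul b c) = amul (amul a b) c;
  amulDl : forall a b c, amul (a + b) c = amul a c + amul b c;
  amulDr : forall a b c, amul a (b + c) = amul a b + amul a c;
  amulZl : forall (k : R[i]) a b, amul (k *: a) b = k *: amul a b;
  amulZr : forall (k : R[i]) a b, amul a (k *: b) = k *: amul a b;
  astarK : forall a, astar (astar a) = a;
  astarD : forall a b, astar (a + b) = astar a + astar b;
  astarZ : forall (k : R[i]) a, astar (k *: a) = k^* *: astar a;
  astarM : forall a b, astar (amul a b) = amul (astar b) (astar a);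
  ler_norm_amul : forall a b, `|amul a b| <= `|a| * `|b|;
  norm_astar_amul : forall a, `|amul (astar a) a| = `|a| ^+ 2
}.

#[short(type="cstarAlgType")]
HB.structure Definition CStarAlg (R : realType) :=
  {A of CompleteNormedModule R[i] A & NormedModule_isCStarAlg R A}.

Section Positivity.
Variables (R : realType) (A : cstarAlgType R).

(* Product of the unitization A (+) C, in which (a, k) stands for a + k1;
   its unit is (0, 1). *)
Definition unitization_mul (u v : A * R[i]) : A * R[i] :=
  (amul u.1 v.1 + u.2 *: v.1 + v.2 *: u.1, u.2 * v.2).

Definition unitization_invertible (u : A * R[i]) : Prop :=
  exists v, unitization_mul u v = (0, 1) /\ unitization_mul v u = (0, 1).

(* The spectrum is taken in the unitization.  When A already has a unit this
   is the spectrum in A together with 0, which does not affect positivity. *)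
Definition spectrum (a : A) : set R[i] :=
  [set z | ~ unitization_invertible (- a, z)].

Definition positive (a : A) : Prop :=
  astar a = a /\ forall z, spectrum a z -> 0 <= z.

End Positivity.

HB.mixin Record Lmodule_isPreHilbert (R : realType) (A : cstarAlgType R) M
    of GRing.Lmodule R[i] M := {
  act : A -> M -> M;
  inner : M -> M -> A;
  actDl : forall a b x, act (a + b) x = act a x + act b x;
  actDr : forall a x y, act a (x + y) = act a x + act a y;
  actA : forall a b x, act (amul a b) x = act a (act b x);
  actZl : forall (k : R[i]) a x, k *: act a x = act (k *: a) x;
  actZr : forall (k : R[i]) a x, k *: act a x = act a (k *: x);
  inner_linear : forall (k : R[i]) x y z,
    inner (k *: x + y) z = k *: inner x z + inner y z;
  inner_act : forall a x y, inner (act a x) y = amul a (inner x y);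
  inner_star : forall x y, astar (inner x y) = inner y x;
  inner_ge0 : forall x, positive (inner x x);
  inner_eq0 : forall x, inner x x = 0 <-> x = 0
}.

#[short(type="preHilbertModType")]
HB.structure Definition PreHilbertMod (R : realType) (A : cstarAlgType R) :=
  {M of GRing.Lmodule R[i] M & Lmodule_isPreHilbert R A M}.

Definition hnorm (R : realType) (A : cstarAlgType R) (M : preHilbertModType A)
  (x : M) : R[i] := sqrtC `|(inner x x : A)|.

Definition hnorm_cauchy (R : realType) (A : cstarAlgType R)
    (M : preHilbertModType A) (x : nat -> M) : Prop :=
  forall e : R[i], 0 < e -> exists N : nat,
    forall m n : nat, (N <= m)%N -> (N <= n)%N -> hnorm (x m - x n) < e.

Definition hnorm_cvg (R : realType) (A : cstarAlgType R)
    (M : preHilbertModType A) (x : nat -> M) (l : M) : Prop :=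
  forall e : R[i], 0 < e -> exists N : nat,
    forall n : nat, (N <= n)%N -> hnorm (x n - l) < e.

HB.mixin Record PreHilbert_isHilbert (R : realType) (A : cstarAlgType R) M
    of PreHilbertMod R A M := {
  hnorm_complete : forall x : nat -> M,
    hnorm_cauchy x -> exists l, hnorm_cvg x l
}.

#[short(type="hilbertModType")]
HB.structure Definition HilbertMod (R : realType) (A : cstarAlgType R) :=
  {M of PreHilbertMod R A M & PreHilbert_isHilbert R A M}.

Definition linear_span (K : pzRingType) (V : lmodType K) (S : set V) : set V :=
  [set v | exists (n : nat) (c : 'I_n -> K) (s : 'I_n -> V),
     (forall i, S (s i)) /\ v = \sum_(i < n) c i *: s i].

Definition finite_dimensional (K : pzRingType) (V : lmodType K) : Prop :=
  exists S : set V, finite_set S /\ linear_span S = setT.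

Definition full (R : realType) (A : cstarAlgType R) (M : hilbertModType A) :
    Prop :=
  dense (linear_span [set a : A | exists x y : M, a = inner x y]).

Definition hnorm_bounded (R : realType) (A : cstarAlgType R)
    (M : preHilbertModType A) (x : nat -> M) : Prop :=
  exists B : R[i], forall n, hnorm (x n) <= B.

Definition condition_H (R : realType) (A : cstarAlgType R)
    (M : hilbertModType A) : Prop :=
  forall x : nat -> M, hnorm_bounded x ->
  exists (phi : nat -> nat) (x0 : M),
    {homo phi : m n / (m < n)%N} /\
    forall y : M, (fun k => inner (x (phi k)) y : A) @ \oo --> (inner x0 y : A).

(* Main.v *)
(** Let tau(a) be the trace of left multiplication by a, when A is finite
    dimensional.  For selfadjoint h the eigenvalues of h on A are real (if
    h v = z v then v^* h v = z v^* v is selfadjoint), so tau(h h) > 0 unless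
    h = 0, and tau dominates the norm on positive elements.  Hence
    Re tau(<x,y>) makes M a real Hilbert space, whose bounded sequences have
    weakly convergent subsequences; tau(<x,y> a) = tau(<x, a^* y>) and the
    nondegeneracy of tau turn this into convergence of <x_n,y> in A.

    Conversely, applying [H] to the sequences a_n x shows that left
    multiplication by a selfadjoint h = <x',w> is compact.  A cluster point v
    of the powers of h is then nonzero with v A finite dimensional, by Riesz.
    If A were infinite dimensional, the annihilator of finitely many ideals
    A v A would be nonzero (it has finite codimension), which yields
    selfadjoint q_0, q_1, ... with q_i A q_j = 0 for i <> j.  Take
    x_i in q_i M of norm 1.  The partial sums s_n of the x_i are bounded; if
    <s_(n_k),y> --> <s,y> for all y, then the elements
    <s_(n_k),s> = \sum_(i < n_k) <x_i,x_i> converge, although their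
    differences have norm at least 1. *)
Require Import Defs.
From HB Require Import structures.
From mathcomp Require Import all_boot all_order all_algebra.
From mathcomp Require Import complex.
From mathcomp Require Import all_classical all_reals all_analysis.
From mathcomp Require Import ring lra.

Set Implicit Arguments.
Unset Strict Implicit.
Unset Printing Implicit Defensive.

Import Order.TTheory GRing.Theory Num.Theory.
Import numFieldNormedType.Exports.

Local Open Scope classical_set_scope.
Local Open Scope ring_scope.

(** * Recursive choice and subsequences *)

Lemma leq_homo_ltn (f : nat -> nat) :
  {homo f : m n / (m < n)%N} -> forall n, (n <= f n)%N.
Proof. by move=> hf; elim=> // n /leq_ltn_trans; apply; exact: hf. Qed.

(** Dependent choice in which each term is chosen in view of the list of all earlier ones: [F n] is
    that list. It serves to build separated unit vectors and mutually orthogonal elements. *)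
Lemma history_choice (T : eqType) (G : T -> Prop) (P : seq T -> T -> Prop) :
  (forall s, {in s, forall x, G x} -> exists2 t, G t & P s t) ->
  exists f : nat -> T, forall n, G (f n) /\ P (mkseq f n) (f n).
Proof.
move=> step.
have [t0 _ _] : exists2 t, G t & P [::] t by apply: step.
have /choice[g gP] : forall s, exists t, {in s, forall x, G x} -> G t /\ P s t.
  move=> s; have [h|h] := pselect {in s, forall x, G x}; last by exists t0.
  by have [t Gt Pt] := step s h; exists t.
pose F := fix F n := if n is m.+1 then rcons (F m) (g (F m)) else [::].
exists (fun n => g (F n)).
have FE n : mkseq (fun n => g (F n)) n = F n.
  by elim: n => //= n IH; rewrite mkseqS IH.
have FG n : {in F n, forall x, G x}.
  elim: n => [|n IH] x //=; rewrite mem_rcons inE => /predU1P[->|/IH//].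
  by have [] := gP _ IH.
by move=> n; rewrite FE; exact: gP.
Qed.

Section RealSequences.
Variable R : realType.
Implicit Types u : nat -> R.

Lemma ltr_norm_sqr (x e : R) : 0 < e -> x ^+ 2 < e ^+ 2 -> `|x| < e.
Proof.
move=> e0; rewrite -(real_normK (num_real x)) ltr_pXn2r ?nnegrE //.
exact: ltW.
Qed.

Lemma cvg_seqP u (l : R) : u @ \oo --> l <->
  forall e : R, 0 < e -> exists N, forall n, (N <= n)%N -> `|u n - l| < e.
Proof.
split=> [/cvgrPdist_lt h e /h [N _ hN]|h].
  by exists N => n Nn; rewrite distrC; apply: hN.
apply/cvgrPdist_lt => e /h[N hN]; exists N => // n Nn.
by rewrite distrC; apply: hN.
Qed.

Lemma cvg0_seqP u : (forall n, 0 <= u n) -> (u @ \oo --> (0 : R) <->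
  forall e : R, 0 < e -> exists N, forall n, (N <= n)%N -> u n < e).
Proof.
move=> u0; rewrite cvg_seqP; split=> h e /h[N hN]; exists N => n /hN.
  by rewrite subr0 ger0_norm.
by rewrite subr0 ger0_norm.
Qed.

Lemma cvg0_le u v : (forall n, 0 <= u n <= v n) -> v @ \oo --> (0 : R) ->
  u @ \oo --> (0 : R).
Proof. by move=> uv v0; apply: (squeeze_cvgr _ (cvg_cst _) v0); exact: nearW. Qed.

Lemma cvg0Ml u (c : R) : u @ \oo --> (0 : R) ->
  (fun n => c * u n) @ \oo --> (0 : R).
Proof. by move=> u0; rewrite -[X in _ --> X](mulr0 c); apply: cvgMr. Qed.

Lemma cvg0D u v : u @ \oo --> (0 : R) -> v @ \oo --> (0 : R) ->
  (fun n => u n + v n) @ \oo --> (0 : R).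
Proof. by move=> u0 v0; rewrite -[X in _ --> X](addr0 0); apply: cvgD. Qed.

Lemma cvg0_sum (I : Type) (s : seq I) (u : I -> nat -> R) :
  (forall i, u i @ \oo --> (0 : R)) ->
  (fun n => \sum_(i <- s) u i n) @ \oo --> (0 : R).
Proof.
move=> u0; elim: s => [|i s IH].
  by under eq_fun do rewrite big_nil; exact: cvg_cst.
by under eq_fun do rewrite big_cons; exact: cvg0D.
Qed.

Lemma homo_ltn_cvg (phi : nat -> nat) :
  {homo phi : m n / (m < n)%N} -> phi @ \oo --> \oo.
Proof.
move=> hphi A [N _ NA]; exists N => // n /= Nn; apply: NA => /=.
by rewrite (leq_trans Nn) // leq_homo_ltn.
Qed.

Lemma cvg_subseq u (l : R) (phi : nat -> nat) :
  {homo phi : m n / (m < n)%N} -> u @ \oo --> l -> (u \o phi) @ \oo --> l.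
Proof. by move=> /homo_ltn_cvg hphi; apply: cvg_comp. Qed.

Lemma cauchy_cvg_seq u :
  (forall e : R, 0 < e -> exists N, forall m n, (N <= m)%N -> (N <= n)%N ->
     `|u m - u n| < e) -> cvgn u.
Proof.
move=> h; apply: cauchy_cvg; apply/cauchy_exP => e e0.
have [N hN] := h e e0; exists (u N); exists N => // n /= Nn.
exact: hN.
Qed.

Lemma bounded_cvg_subseq u (B : R) : (forall n, `|u n| <= B) ->
  exists phi, {homo phi : m n / (m < n)%N} /\ cvgn (u \o phi).
Proof.
move=> uB; have [|phi phi_incr phi_cvg] := @bolzano_weierstrass R u.
  exists B; split; first exact: num_real.
  by move=> x Bx n _; exact: le_trans (uB n) (ltW Bx).
by exists phi; split=> // m n; rewrite (leqW_mono phi_incr).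
Qed.

(** Cantor's diagonal argument: [F m.+1] refines [F m] so that [u m] converges along it, and the
    diagonal is eventually a subsequence of every [F m]. *)
Lemma diagonal_cvg_subseq (u : nat -> nat -> R) :
  (forall m, exists B, forall n, `|u m n| <= B) ->
  exists phi, {homo phi : m n / (m < n)%N} /\ forall m, cvgn (u m \o phi).
Proof.
move=> uB.
have /choice[next nextP] : forall p : nat * (nat -> nat), exists psi,
    {homo psi : m n / (m < n)%N} /\ cvgn (u p.1 \o (p.2 \o psi)).
  move=> [m phi] /=; have [B hB] := uB m.
  have [psi [h1 h2]] := @bounded_cvg_subseq (u m \o phi) B (fun n => hB (phi n)).
  by exists psi.
pose F := fix F n := if n is m.+1 then F m \o next (m, F m) else id.
have homoF n : {homo F n : i j / (i < j)%N}.
  by elim: n => //= n IH i j ij; apply: IH; apply: (nextP (n, F n)).1.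
have split_F m k : exists theta, {homo theta : i j / (i < j)%N} /\
    F (k + m)%N = F m \o theta.
  elim: k => [|k [theta [h1 h2]]]; first by exists id; split.
  exists (theta \o next ((k + m)%N, F (k + m)%N)); split.
    by move=> i j ij; apply: h1; apply: (nextP (_, _)).1.
  by rewrite -[RHS]/((F m \o theta) \o next _) -h2.
exists (fun k => F k k); split=> [|m].
  apply: homo_ltn => [|k]; first exact: ltn_trans.
  rewrite /=; apply: homoF.
  by apply: leq_homo_ltn; apply: (nextP (_, _)).1.
have /cvg_ex[l /= /cvg_seqP hl] := (nextP (m, F m)).2.
apply/cvg_ex; exists l; apply/cvg_seqP => e /hl[N hN].
(* Only from index [m.+1] on does [F k] factor through [F m.+1]. *)
exists (maxn N m.+1) => k; rewrite geq_max => /andP[Nk mk] /=.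
have [theta [h1]] := split_F m.+1 (k - m.+1)%N.
rewrite subnK // => ->; apply: hN; rewrite (leq_trans Nk) //.
exact: leq_homo_ltn.
Qed.

(** The quadratic is evaluated at its minimiser [- b / q]; when [q = 0] and [b <> 0], a suitable [t]
    gives the value -1. *)
Lemma discr_le (d b q : R) : 0 <= q ->
  (forall t, 0 <= d + 2 * t * b + t ^+ 2 * q) -> b ^+ 2 <= d * q.
Proof.
rewrite le_eqVlt => /predU1P[<-|q0] h.
  have [->|b0] := eqVneq b 0; first by rewrite expr0n mulr0.
  have := h (- (d + 1) / (2 * b)).
  have -> : d + 2 * (- (d + 1) / (2 * b)) * b + (- (d + 1) / (2 * b)) ^+ 2 * 0
    = -1 by field.
  by rewrite ler0N1.
have := h (- b / q).
have -> : d + 2 * (- b / q) * b + (- b / q) ^+ 2 * q = d - b ^+ 2 / q.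
  by field; rewrite gt_eqF.
by rewrite subr_ge0 ler_pdivrMr.
Qed.

End RealSequences.

(** * Weak compactness in real Hilbert spaces *)

Section RealHilbert.
Variables (R : realType) (V : lmodType R) (r : V -> V -> R).
Hypothesis r_linear : forall a x y z, r (a *: x + y) z = a * r x z + r y z.
Hypothesis r_sym : forall x y, r x y = r y x.
Hypothesis r_ge0 : forall x, 0 <= r x x.

Let rDl x y z : r (x + y) z = r x z + r y z.
Proof. by rewrite -[x]scale1r r_linear mul1r scale1r. Qed.

Let r0l z : r 0 z = 0.
Proof. by apply: (addrI (r 0 z)); rewrite -rDl !addr0. Qed.

Let rZl a x z : r (a *: x) z = a * r x z.
Proof. by rewrite -[a *: x]addr0 r_linear r0l addr0. Qed.

Let rNl x z : r (- x) z = - r x z.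
Proof. by rewrite -scaleN1r rZl mulN1r. Qed.

Let rDr x y z : r z (x + y) = r z x + r z y.
Proof. by rewrite r_sym rDl !(r_sym z). Qed.

Let rZr a x z : r z (a *: x) = a * r z x.
Proof. by rewrite r_sym rZl (r_sym z). Qed.

Let rNr x z : r z (- x) = - r z x.
Proof. by rewrite r_sym rNl (r_sym z). Qed.

Let rE := (rDl, rDr, rZl, rZr, rNl, rNr).

Lemma psd_cauchy_schwarz x y : r x y ^+ 2 <= r x x * r y y.
Proof.
apply: discr_le => // t; have := r_ge0 (x + t *: y).
by rewrite !rE (r_sym y x); congr (_ <= _); ring.
Qed.

Hypothesis r_complete : forall x : nat -> V,
  (forall e : R, 0 < e -> exists N, forall m n, (N <= m)%N -> (N <= n)%N ->
     r (x m - x n) (x m - x n) < e) ->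
  exists l, (fun n => r (x n - l) (x n - l)) @ \oo --> (0 : R).

Lemma cvg_inner (x : nat -> V) (l y : V) :
  (fun n => r (x n - l) (x n - l)) @ \oo --> (0 : R) ->
  (fun n => r (x n) y) @ \oo --> r l y.
Proof.
move=> /(cvg0Ml (r y y)) /cvg_seqP h; apply/cvg_seqP => e e0.
have [N hN] := h _ (exprn_gt0 2 e0); exists N => n /hN.
rewrite subr0 => hn; rewrite -rNl -rDl; apply: ltr_norm_sqr => //.
apply: le_lt_trans hn.
apply: le_trans (ler_norm _); rewrite mulrC; exact: psd_cauchy_schwarz.
Qed.

(** Direct method: [Q z = r z z - 2 * f z] is bounded below on [L], and the limit of a minimising
    sequence represents [f]. With [f = r y] this is orthogonal projection onto [L]; with [L] the
    whole space it is the Riesz representation theorem. *)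
Lemma riesz_subspace (L : V -> Prop) (f : V -> R) (C : R) :
  L 0 -> (forall a x y, L x -> L y -> L (a *: x + y)) ->
  (forall x l, (forall n, L (x n)) ->
    (fun n => r (x n - l) (x n - l)) @ \oo --> (0 : R) -> L l) ->
  (forall a x y, L x -> L y -> f (a *: x + y) = a * f x + f y) ->
  (forall x, L x -> f x ^+ 2 <= C * r x x) ->
  exists2 x0, L x0 & forall z, L z -> f z = r x0 z.
Proof.
move=> L0 LD Lcl fD fC.
have f0 : f 0 = 0.
  by have := fD 1 0 0 L0 L0; rewrite scaler0 addr0; lra.
have LZ a x : L x -> L (a *: x) by move=> Lx; have := LD a x 0 Lx L0; rewrite addr0.
have fZ a x : L x -> f (a *: x) = a * f x.
  by move=> Lx; have := fD a x 0 Lx L0; rewrite !addr0 f0 addr0.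
pose Q z := r z z - 2 * f z.
pose K := `|C| + 1; have K0 : 0 < K by rewrite ltr_pwDr.
have QK z : L z -> - K <= Q z.
  move=> /fC fz; have {}fz : f z ^+ 2 <= K * r z z.
    apply: le_trans fz _; apply: ler_wpM2r => //.
    by rewrite (le_trans (ler_norm C)) // lerDl.
  (* After multiplication by [K], complete the square: [K * r z z - 2 * K * f z >= f z ^+ 2 - 2 * K
     * f z >= - K ^+ 2]. *)
  rewrite -(ler_pM2l K0) /Q.
  have := sqr_ge0 (f z - K); lra.
pose S := [set Q z | z in L].
have Sinf : has_inf S by split; [exists (Q 0), 0|exists (- K) => _ [z /QK ? <-]].
have Qinf z : L z -> inf S <= Q z.
  by move=> Lz; apply: (ge_inf Sinf.2); exists z.
have /choice[z_ zP] : forall n, exists z, L z /\ Q z < inf S + n.+1%:R^-1.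
  move=> n; have [|_ [z Lz <-] Qz] := @inf_adherent _ S n.+1%:R^-1 _ Sinf.
    by rewrite invr_gt0 ltr0n.
  by exists z.
have cvgd : (fun n => n.+1%:R^-1 : R) @ \oo --> (0 : R).
  exact: cvg_harmonic.
have d0 n : 0 <= n.+1%:R^-1 :> R by rewrite invr_ge0.
have cvgd' := (cvg0_seqP d0).1 cvgd.
(* Parallelogram law: [Q] of the midpoint is at least [inf S], and the linear terms cancel. *)
have par z w : L z -> L w ->
    r (z - w) (z - w) <= 2 * (Q z - inf S) + 2 * (Q w - inf S).
  move=> Lz Lw; have Lm : L (2^-1 *: z + 2^-1 *: w) by apply: LD => //; exact: LZ.
  have := Qinf _ Lm; rewrite /Q fD ?fZ //; last exact: LZ.
  rewrite !rE (r_sym w z); lra.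
have [|l lP] := r_complete (x := z_).
  move=> e e0.
  have [|N hN] := cvgd' (e / 4); first by rewrite divr_gt0.
  have Qlt k : (N <= k)%N -> Q (z_ k) < inf S + e / 4.
    by move=> /hN hk; apply: lt_trans (zP k).2 _; rewrite ltrD2l.
  exists N => m n /Qlt Nm /Qlt Nn.
  apply: le_lt_trans (par _ _ (zP m).1 (zP n).1) _.
  by lra.
exists l; first by apply: Lcl lP => n; exact: (zP n).1.
move=> z Lz; rewrite -(cvg_lim _ (@cvg_inner _ _ z lP)) //.
apply/esym/cvg_lim => //.
apply/cvg_seqP => e e0.
have /cvg_seqP/(_ _ (exprn_gt0 2 e0))[N hN] := cvg0Ml (r z z) cvgd.
exists N => n /hN; rewrite subr0 => hn.
apply: ltr_norm_sqr => //; apply: le_lt_trans (lt_le_trans hn _) => //.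
(* For every [t], [Q (t *: z + z_ n)] is at least [inf S], which exceeds [Q (z_ n) - n.+1%:R^-1];
   the discriminant then bounds the square of [r (z_ n) z - f z]. *)
apply: le_trans (ler_norm _); rewrite mulrC; apply: discr_le => // t.
have := Qinf _ (LD t _ _ Lz (zP n).1); have := (zP n).2.
rewrite /Q fD //; last exact: (zP n).1.
rewrite !rE (r_sym z); move: (n.+1%:R^-1) => d; lra.
Qed.

Lemma bounded_weakly_cvg_subseq (x : nat -> V) (B : R) :
  (forall n, r (x n) (x n) <= B) ->
  exists phi x0, {homo phi : m n / (m < n)%N} /\
    forall y, (fun k => r (x (phi k)) y) @ \oo --> r x0 y.
Proof.
move=> xB.
have B0 : 0 <= B by apply: le_trans (xB 0%N).
have bnd n y : r (x n) y ^+ 2 <= B * r y y.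
  by apply: le_trans (psd_cauchy_schwarz _ _) _; exact: ler_wpM2r.
have bnd1 n y : `|r (x n) y| <= Num.sqrt (B * r y y).
  by rewrite -sqrtr_sqr ler_wsqrtr.
have [m|phi [phi_homo phi_cvg]] :=
    @diagonal_cvg_subseq R (fun m n => r (x n) (x m)).
  by exists (Num.sqrt (B * r (x m) (x m))).
pose L y := cvgn (fun k => r (x (phi k)) y).
have L0 : L 0.
  apply/cvg_ex; exists 0; under eq_fun do rewrite r_sym r0l.
  exact: cvg_cst.
have LD a y z : L y -> L z -> L (a *: y + z).
  move=> /cvg_ex[l1 h1] /cvg_ex[l2 h2]; apply/cvg_ex; exists (a * l1 + l2).
  under eq_fun do rewrite rDr rZr.
  by apply: cvgD => //; apply: cvgMr.
have Lcl y l : (forall n, L (y n)) ->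
    (fun n => r (y n - l) (y n - l)) @ \oo --> (0 : R) -> L l.
  move=> Ly yl; apply: cauchy_cvg_seq => e e0.
  have e30 : 0 < e / 3 by rewrite divr_gt0.
  have /cvg_seqP/(_ _ (exprn_gt0 2 e30))[N hN] := cvg0Ml B yl.
  have /cvg_ex[l0 /cvg_seqP/(_ (e / 6))[|M hM]] := Ly N.
    by rewrite divr_gt0.
  have close k : `|r (x (phi k)) (y N) - r (x (phi k)) l| < e / 3.
    rewrite -rNr -rDr; apply: ltr_norm_sqr => //; apply: le_lt_trans (bnd _ _) _.
    by have := hN N (leqnn N); rewrite subr0; apply: le_lt_trans; exact: ler_norm.
  exists M => m n /hM hm /hM hn.
  have := close m; have := close n; move: hm hn.
  rewrite !ltr_norml => /andP[? ?] /andP[? ?] /andP[? ?] /andP[? ?].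
  by apply/andP; split; lra.
(* Replacing [y] by its projection [y0] on [L] does not change its products with the [x (phi k)],
   which lie in [L]. *)
have Lall y : L y.
  have [||y0 Ly0 hy0] := @riesz_subspace L (r y) (r y y) L0 LD Lcl.
  - by move=> a u v _ _; rewrite rDr rZr.
  - by move=> u _; exact: psd_cauchy_schwarz.
  rewrite /L (_ : (fun k => _) = fun k => r (x (phi k)) y0) //.
  by apply/funext => k; rewrite r_sym hy0 1?r_sym //; exact: phi_cvg.
(* The limit functional is bounded, so it is represented by the weak limit [x0]. *)
pose g y := limn (fun k => r (x (phi k)) y).
have [//|//|a y z _ _|y _|x0 _ hx0] := @riesz_subspace (fun=> True) g B I.
- rewrite /g; apply: cvg_lim => //.
  under eq_fun do rewrite rDr rZr.
  by apply: cvgD; [apply: cvgMr|]; exact: Lall.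
- have h : (fun k => r (x (phi k)) y) @ \oo --> g y by exact: Lall.
  have h2 : (fun k => r (x (phi k)) y * r (x (phi k)) y) @ \oo --> g y * g y.
    exact: (cvgM h h).
  rewrite expr2 -(cvg_lim _ h2) //; apply: limr_le; first exact: cvgP h2.
  by apply: nearW => k; exact: bnd.
exists phi, x0; split=> // y; rewrite -hx0 //; exact: Lall.
Qed.

End RealHilbert.

(** * Finite spans *)

Section Spans.
Variables (K : fieldType) (V : lmodType K).
Implicit Types (s t : seq V) (W : V -> Prop).

(** Generators are peeled off one at a time, which suits induction on the list. *)
Fixpoint lspan s (v : V) : Prop :=
  if s is g :: s' then exists k : K, lspan s' (v - k *: g) else v = 0.

Definition subspace W := W 0 /\ forall a x y, W x -> W y -> W (a *: x + y).

(** The spanning list may leave [W], so the notion passes to arbitrary subsets; [subspace_basis]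
    finds generators inside a subspace. *)
Definition fdim W := exists s, forall v, W v -> lspan s v.

Lemma fdim_sub W W' : (forall v, W v -> W' v) -> fdim W' -> fdim W.
Proof. by move=> h [s hs]; exists s => v /h/hs. Qed.

Lemma lspan_subspace s : subspace (lspan s).
Proof.
elim: s => [|g s [IH0 IHD]]; first by split=> //= a x y -> ->; rewrite scaler0 addr0.
split=> [|a x y [k hk] [l hl]]; first by exists 0; rewrite scale0r subr0.
exists (a * k + l); have := IHD a _ _ hk hl; congr lspan.
by rewrite scalerBr scalerDl scalerA opprD addrACA.
Qed.

Lemma subspaceZ W a x : subspace W -> W x -> W (a *: x).
Proof. by move=> [W0 WD] Wx; rewrite -[_ *: _]addr0; apply: WD. Qed.

Lemma subspaceD W x y : subspace W -> W x -> W y -> W (x + y).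
Proof. by move=> [W0 WD] Wx Wy; rewrite -[x]scale1r; apply: WD. Qed.

Lemma subspaceB W x y : subspace W -> W x -> W y -> W (x - y).
Proof.
by move=> hW Wx Wy; apply: subspaceD => //; rewrite -scaleN1r; apply: subspaceZ.
Qed.

Lemma lspan_least W s v : subspace W -> {in s, forall x, W x} -> lspan s v -> W v.
Proof.
move=> hW; elim: s v => [|g s IH] v sW /=; first by move=> ->; exact: hW.1.
move=> [k hk]; rewrite -(subrK (k *: g) v); apply: subspaceD => //.
  by apply: IH => // x xs; apply: sW; rewrite inE xs orbT.
by apply: subspaceZ => //; apply: sW; rewrite mem_head.
Qed.

Lemma mem_lspan s : {in s, forall x, lspan s x}.
Proof.
elim: s => [//|g s IH] x; rewrite inE => /predU1P[->|/IH xs] /=.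
  by exists 1; rewrite scale1r subrr; exact: (lspan_subspace s).1.
by exists 0; rewrite scale0r subr0.
Qed.

Lemma lspan_sub s t v : {subset s <= t} -> lspan s v -> lspan t v.
Proof.
move=> st; apply: lspan_least; first exact: lspan_subspace.
by move=> x /st; exact: mem_lspan.
Qed.

(** Elimination of one generator: if some [w] in [W] has a nonzero coefficient [c] at [g],
    subtracting a multiple of [w] moves any element of [W] into the span of the remaining list. *)
Lemma subspace_basis W s : subspace W -> (forall v, W v -> lspan s v) ->
  exists2 t, {in t, forall x, W x} & forall v, W v -> lspan t v.
Proof.
elim: s W => [|g s IH] W hW Ws; first by exists [::].
have [h|/existsNP[w /not_implyP[Ww ws]]] := pselect (forall v, W v -> lspan s v).
  exact: IH.
have [c hc] := Ws w Ww.
have c0 : c != 0 by apply: contra_notN ws => /eqP c0; rewrite c0 scale0r subr0 in hc.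
pose W' v := W v /\ lspan s v.
have hs := lspan_subspace s.
have hW' : subspace W'.
  split; first by split; [exact: hW.1|exact: hs.1].
  by move=> a x y [? ?] [? ?]; split; [exact: hW.2|exact: hs.2].
have [t tW' ht] := IH W' hW' (fun v Wv => Wv.2).
exists (w :: t) => [x|v Wv /=].
  by rewrite inE => /predU1P[->//|/tW'[]].
have [d hd] := Ws v Wv; exists (d / c); apply: ht; split.
  by apply: subspaceB => //; exact: subspaceZ.
have := subspaceB hs hd (subspaceZ (d / c) hs hc); congr lspan.
by rewrite scalerBr scalerA divfK // opprB addrA subrK.
Qed.

Lemma lspan_map_lift (f : V -> V) u z :
  (forall a x y, f (a *: x + y) = a *: f x + f y) ->
  lspan (map f u) z -> exists2 w, lspan u w & f w = z.
Proof.
move=> fD; have f0 : f 0 = 0.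
  by apply: (addrI (f 0)); rewrite -{1}[f 0]scale1r -fD scaler0 !addr0.
elim: u z => [|g u IH] z /=; first by move=> ->; exists 0.
move=> [k /IH[w hw fw]]; exists (k *: g + w); first by exists k; rewrite addrAC subrr add0r.
by rewrite fD fw addrC subrK.
Qed.

(** Rank-nullity: generators of the kernel together with lifts of generators of the image span
    [W]. *)
Lemma fdim_ker_image W (f : V -> V) s :
  (forall a x y, f (a *: x + y) = a *: f x + f y) -> subspace W ->
  (forall v, W v -> lspan s (f v)) -> fdim (fun v => W v /\ f v = 0) -> fdim W.
Proof.
move=> fD hW Ws [k hk].
have f0 : f 0 = 0.
  by apply: (addrI (f 0)); rewrite -{1}[f 0]scale1r -fD scaler0 !addr0.
have [||t tW ht] := @subspace_basis (fun z => exists2 v, W v & f v = z) s.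
- split; first by exists 0 => //; exact: hW.1.
  move=> a _ _ [x Wx <-] [y Wy <-]; exists (a *: x + y) => //; exact: hW.2.
- by move=> _ [v Wv <-]; exact: Ws.
have [u uW tE] : exists2 u, {in u, forall x, W x} & t = map f u.
  elim: t tW {ht} => [|z t IH] tW; first by exists [::].
  have [x xt|u uW ->] := IH; first by apply: tW; rewrite inE xt orbT.
  have [v Wv <-] := tW z (mem_head _ _); exists (v :: u) => // x.
  by rewrite inE => /predU1P[->|/uW].
exists (u ++ k) => v Wv; have hs := lspan_subspace (u ++ k).
have [|w uw fw] := @lspan_map_lift f u (f v) fD; first by rewrite -tE; apply: ht; exists v.
rewrite -(subrK w v); apply: subspaceD => //; last first.
  by apply: lspan_sub uw => x; rewrite mem_cat => ->.
apply: (@lspan_sub k); first by move=> x; rewrite mem_cat orbC => ->.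
apply: hk; split; first by apply: subspaceB => //; exact: lspan_least uw.
by rewrite addrC -scaleN1r fD fw scaleN1r addrC subrr.
Qed.

Lemma lspan_linear_span s v : lspan s v -> linear_span [set` s] v.
Proof.
suff : forall s' : seq V, {subset s' <= s} -> lspan s' v -> linear_span [set` s] v.
  by apply.
move=> s'; elim: s' v => [|g s' IH] v /= ss.
  by move=> ->; exists 0%N, (fun=> 0), (fun=> 0); split=> [[]//|]; rewrite big_ord0.
move=> [k] /IH[x xs|n [c [w [ws vE]]]]; first by apply: ss; rewrite inE xs orbT.
exists n.+1, (fun i => if unlift ord0 i is Some j then c j else k),
  (fun i => if unlift ord0 i is Some j then w j else g); split=> [i|].
  by case: unliftP => [j _|_]; [exact: ws|rewrite /= ss ?mem_head].
rewrite big_ord_recl unlift_none; under eq_bigr do rewrite liftK.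
by rewrite -vE addrC subrK.
Qed.

Lemma fdim_finite_dimensional : fdim (fun=> True) -> finite_dimensional V.
Proof.
move=> [s hs]; exists [set` s]; split; first exact: finite_seq.
by apply/seteqP; split=> // v _; apply: lspan_linear_span; exact: hs.
Qed.

End Spans.

(** * Real-valued norms on complex normed spaces *)

Section ComplexNorm.
Variable R : realType.

(** Norms take values in [R[i]]; their real parts allow total comparisons and limits in [R]. *)
Definition rnorm (V : normedZmodType R[i]) (x : V) : R := complex.Re `|x|.

Section NormedZmod.
Variable V : normedZmodType R[i].
Implicit Types x y : V.

Lemma rnormE x : `|x| = (rnorm x)%:C%C.
Proof. by rewrite /rnorm RRe_real // ger0_real. Qed.

Lemma rnorm_ge0 x : 0 <= rnorm x.
Proof. by have := normr_ge0 x; rewrite rnormE ler0c. Qed.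

Lemma rnorm0 : rnorm (0 : V) = 0.
Proof. by rewrite /rnorm normr0. Qed.

Lemma rnorm_eq0 x : rnorm x = 0 -> x = 0.
Proof. by move=> h; apply/eqP; rewrite -normr_eq0 rnormE h. Qed.

Lemma rnorm_gt0 x : x != 0 -> 0 < rnorm x.
Proof. by move=> x0; rewrite lt0r rnorm_ge0 andbT; apply: contra_neq x0 => /rnorm_eq0. Qed.

Lemma rnormN x : rnorm (- x) = rnorm x.
Proof. by rewrite /rnorm normrN. Qed.

Lemma rnorm_distC x y : rnorm (x - y) = rnorm (y - x).
Proof. by rewrite /rnorm distrC. Qed.

Lemma ler_rnormD x y : rnorm (x + y) <= rnorm x + rnorm y.
Proof. by have := ler_normD x y; rewrite !rnormE -rmorphD lecR. Qed.

Lemma ler_rnormB x y : rnorm (x - y) <= rnorm x + rnorm y.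
Proof. by rewrite -(rnormN y); exact: ler_rnormD. Qed.

Lemma ler_rnorm_dist x y z : rnorm (x - z) <= rnorm (x - y) + rnorm (y - z).
Proof. by have := ler_rnormD (x - y) (y - z); rewrite addrA subrK. Qed.

Lemma ler_rnorm_sum (I : Type) (s : seq I) (F : I -> V) :
  rnorm (\sum_(i <- s) F i) <= \sum_(i <- s) rnorm (F i).
Proof.
elim/big_ind2: _ => [|x1 x2 y1 y2 h1 h2|i _ //]; first by rewrite rnorm0.
exact: le_trans (ler_rnormD _ _) (lerD h1 h2).
Qed.

End NormedZmod.

Lemma ler_Re_rnorm (k : R[i]) : `|complex.Re k| <= rnorm k.
Proof. by have := normc_ge_Re k; rewrite rnormE lecR. Qed.

Lemma rnormM (k l : R[i]) : rnorm (k * l) = rnorm k * rnorm l.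
Proof. by apply: complexI; rewrite rmorphM -!rnormE normrM. Qed.

Lemma rnorm_real (x : R) : rnorm (x%:C%C : R[i]) = `|x|.
Proof. by rewrite /rnorm normc_def /= expr0n addr0 sqrtr_sqr. Qed.

Lemma ler_Im_rnorm (k : R[i]) : `|complex.Im k| <= rnorm k.
Proof.
by rewrite /rnorm normc_def /= -sqrtr_sqr ler_wsqrtr // lerDr sqr_ge0.
Qed.

Lemma ler_rnorm_ReIm (k : R[i]) :
  rnorm k <= `|complex.Re k| + `|complex.Im k|.
Proof.
rewrite /rnorm normc_def /= -[leRHS]ger0_norm ?addr_ge0 // -sqrtr_sqr ler_wsqrtr //.
by rewrite sqrrD !real_normK ?num_real // lerD2r lerDl mulrn_wge0 ?mulr_ge0.
Qed.

Lemma rnormZ (V : normedModType R[i]) (k : R[i]) (x : V) :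
  rnorm (k *: x) = rnorm k * rnorm x.
Proof. by have := normrZ k x; rewrite !rnormE -rmorphM => /complexI. Qed.

Lemma bounded_complex_cvg_subseq (k : nat -> R[i]) (B : R) :
  (forall n, rnorm (k n) <= B) ->
  exists phi l, {homo phi : m n / (m < n)%N} /\
    (fun n => rnorm (k (phi n) - l)) @ \oo --> (0 : R).
Proof.
move=> kB.
have [phi [hphi /cvg_ex[a /= ha]]] := @bounded_cvg_subseq R (fun n => complex.Re (k n)) B
  (fun n => le_trans (ler_Re_rnorm _) (kB n)).
have [psi [hpsi /cvg_ex[b /= hb]]] :=
  @bounded_cvg_subseq R (fun n => complex.Im (k (phi n))) B
  (fun n => le_trans (ler_Im_rnorm _) (kB _)).
exists (phi \o psi), (Complex a b); split; first by move=> m n mn; exact/hphi/hpsi.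
apply: cvg0_le (cvg0D _ _) => [n||].
- rewrite rnorm_ge0 /=; exact: ler_rnorm_ReIm.
- have := cvg_subseq hpsi ha => /cvg_seqP h; apply/cvg_seqP => e /h[N hN].
  exists N => n /hN; rewrite subr0 normr_id /=.
  by case: (k _) => x y.
- move/cvg_seqP: hb => h; apply/cvg_seqP => e /h[N hN].
  exists N => n /hN; rewrite subr0 normr_id /=.
  by case: (k _) => x y.
Qed.

(** * Riesz's lemma and compact maps *)

Section FiniteSpans.
Variable V : normedModType R[i].
Implicit Types (s : seq V) (u v : V).

(** Finite spans are closed. If points [f n] of the span of [g :: s] tend to [u], their coefficients
    [t n] at [g] are bounded because [g] has positive distance [dg] from the span of [s]; a cluster
    point [l] puts [u - l *: g] at distance zero from that span, against induction. *)
Lemma lspan_dist_gt0 s u : ~ lspan s u ->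
  exists2 d, 0 < d & forall f, lspan s f -> d <= rnorm (u - f).
Proof.
elim: s u => [|g s IH] u us.
  exists (rnorm u); last by move=> f ->; rewrite subr0.
  by apply: rnorm_gt0; exact/eqP.
have hs := lspan_subspace s.
have [gs|/IH[dg dg0 hg]] := pselect (lspan s g).
  have sub f : lspan (g :: s) f -> lspan s f.
    apply: lspan_least => // x; rewrite inE => /predU1P[->//|]; exact: mem_lspan.
  have [|d d0 hd] := IH u; last by exists d => // f /sub; exact: hd.
  by apply: contra_not us; apply: lspan_sub => x xs; rewrite inE xs orbT.
apply: contrapT => nod.
have /choice[f fP] : forall n, exists f,
    lspan (g :: s) f /\ rnorm (u - f) < n.+1%:R^-1.
  move=> n; apply: contrapT => /forallNP h; apply: nod.
  exists n.+1%:R^-1 => [|f fs]; first by rewrite invr_gt0.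
  by rewrite leNgt; apply/negP => h2; apply: (h f).
have /choice[t tP] : forall n, exists t, lspan s (f n - t *: g).
  by move=> n; have [[t ht] _] := fP n; exists t.
have tB n : rnorm (t n) <= (rnorm u + 1) / dg.
  rewrite ler_pdivlMr //; apply: (@le_trans _ _ (rnorm (f n))); last first.
    rewrite -[f n](subKr u); apply: le_trans (ler_rnormB _ _) _.
    rewrite lerD2l (le_trans (ltW (fP n).2)) // invf_le1 // ler1n //.
  have [->|t0] := eqVneq (t n) 0; first by rewrite rnorm0 mul0r rnorm_ge0.
  have -> : f n = t n *: (g - - (t n)^-1 *: (f n - t n *: g)).
    by rewrite scaleNr opprK scalerDr scalerA divff // scale1r addrC subrK.
  rewrite rnormZ ler_wpM2l ?rnorm_ge0 // hg //; exact: subspaceZ.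
have [phi [l [hphi tl]]] := bounded_complex_cvg_subseq tB.
have [|d d0 hd] := IH (u - l *: g); first by move=> h; apply: us; exists l.
have : (fun n => rnorm (t (phi n) - l) * rnorm g + (phi n).+1%:R^-1) @ \oo --> (0 : R).
  apply: cvg0D.
    by under eq_fun do rewrite mulrC; exact: cvg0Ml.
  exact: (cvg_subseq hphi (@cvg_harmonic R)).
move=> /cvg_seqP/(_ d d0)[N /(_ N (leqnn N))]; rewrite subr0 => hN.
have := le_lt_trans (ler_norm _) hN; rewrite ltNge => /negP; apply.
apply: le_trans (hd _ (tP (phi N))) _.
rewrite -rnormZ; apply: le_trans (lerD (lexx _) (ltW (fP (phi N)).2)).
apply: le_trans (ler_rnormD _ _); rewrite le_eqVlt; apply/predU1P; left.
congr rnorm; rewrite scalerBl opprB addrACA [RHS]addrC [RHS]addrACA.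
by congr (_ + _); rewrite addrC.
Qed.

Lemma riesz_lemma (W : V -> Prop) s u : subspace W -> {in s, forall x, W x} ->
  W u -> ~ lspan s u ->
  exists v, [/\ W v, rnorm v = 1 & forall f, lspan s f -> 2^-1 <= rnorm (v - f)].
Proof.
move=> hW sW Wu us; have hs := lspan_subspace s.
have [d d0 hd] := lspan_dist_gt0 us.
pose S := [set rnorm (u - f) | f in lspan s].
have Sinf : has_inf S.
  by split; [exists (rnorm (u - 0)), 0 => //; exact: hs.1|exists d => _ [f /hd ? <-]].
have dS : d <= inf S by apply: lb_le_inf; [exact: Sinf.1|move=> _ [f /hd ? <-]].
(* The slack is [inf S] itself, so [N < 2 * inf S]; normalising [u - f0] then leaves distance at
   least 1/2. *)
have [_ [f0 sf0 <-] hf0] := inf_adherent (lt_le_trans d0 dS) Sinf.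
set N := rnorm (u - f0) in hf0.
have N0 : 0 < N by apply: lt_le_trans d0 _; exact: hd.
have nN : rnorm ((N^-1)%:C%C : R[i]) = N^-1.
  by rewrite rnorm_real ger0_norm // invr_ge0 ltW.
exists ((N^-1)%:C%C *: (u - f0)); split.
- by apply: subspaceZ => //; apply: subspaceB => //; exact: lspan_least sf0.
- by rewrite rnormZ nN mulVf // gt_eqF.
move=> f sf.
have -> : (N^-1)%:C%C *: (u - f0) - f = (N^-1)%:C%C *: (u - (f0 + N%:C%C *: f)).
  rewrite opprD addrA [RHS]scalerBr scalerA -rmorphM mulVf ?gt_eqF //.
  by rewrite scale1r.
rewrite rnormZ nN mulrC ler_pdivlMr // mulrC ler_pdivrMr //.
have : inf S <= rnorm (u - (f0 + N%:C%C *: f)).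
  apply: (ge_inf Sinf.2); exists (f0 + N%:C%C *: f) => //.
  by apply: subspaceD => //; exact: subspaceZ.
lra.
Qed.

(** Otherwise Riesz's lemma gives unit vectors in [W] at mutual distance at least 1/2. Their images
    are [c / 2] apart, yet two of them lie within [c / 4] of one limit. *)
Lemma compact_bounded_below_fdim (W : V -> Prop) (T : V -> V) (c : R) :
  subspace W -> (forall x y, T (x - y) = T x - T y) -> 0 < c ->
  (forall x, W x -> c * rnorm x <= rnorm (T x)) ->
  (forall a : nat -> V, (forall n, rnorm (a n) <= 1) ->
     exists phi l, {homo phi : m n / (m < n)%N} /\
       (fun n => rnorm (T (a (phi n)) - l)) @ \oo --> (0 : R)) ->
  fdim W.
Proof.
move=> hW TB c0 cT Tcpt; apply: contrapT => /forallNP nW.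
have [s sW|a aP] := @history_choice V (fun v => W v /\ rnorm v = 1)
    (fun s v => forall f, lspan s f -> 2^-1 <= rnorm (v - f)).
  have /existsNP[u /not_implyP[Wu us]] := nW s.
  have [|v [Wv v1 hv]] := riesz_lemma hW _ Wu us; first by move=> x /sW[].
  by exists v.
have [|phi [l [hphi]]] := Tcpt a; first by move=> n; rewrite (aP n).1.2.
have c40 : 0 < c / 4 by rewrite divr_gt0.
move=> /cvg_seqP/(_ _ c40)[N hN].
have := hN N (leqnn N); have := hN N.+1 (leqnSn N).
rewrite !subr0 !ger0_norm ?rnorm_ge0 // => h1 h2.
have : 2^-1 <= rnorm (a (phi N.+1) - a (phi N)).
  apply: (aP _).2; apply: mem_lspan; apply/mapP; exists (phi N) => //.
  by rewrite mem_iota /= add0n hphi.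
have : c * rnorm (a (phi N.+1) - a (phi N)) <= rnorm (T (a (phi N.+1)) - T (a (phi N))).
  by rewrite -TB; apply: cT; apply: subspaceB => //; exact: (aP _).1.1.
have := ler_rnorm_dist (T (a (phi N.+1))) l (T (a (phi N))).
rewrite (rnorm_distC l); set x := rnorm (_ - a (phi N)).
move=> h3 h4 h5; have : c * 2^-1 <= c * x by rewrite ler_pM2l.
lra.
Qed.

End FiniteSpans.
End ComplexNorm.

(** * Norms and powers in a C*-algebra *)

Section CStarBasics.
Variables (R : realType) (A : cstarAlgType R).
Implicit Types a b c h : A.

Lemma amulBl a b c : amul (a - b) c = amul a c - amul b c.
Proof. by rewrite amulDl -scaleN1r amulZl scaleN1r. Qed.

Lemma amulBr a b c : amul a (b - c) = amul a b - amul a c.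
Proof. by rewrite amulDr -[- c]scaleN1r amulZr scaleN1r. Qed.

Lemma amul0l a : amul 0 a = 0.
Proof. by have := amulZl 0 (0 : A) a; rewrite !scale0r. Qed.

Lemma amul0r a : amul a 0 = 0.
Proof. by have := amulZr 0 a (0 : A); rewrite !scale0r. Qed.

Lemma amul_sumr (I : Type) (s : seq I) (F : I -> A) a :
  amul a (\sum_(i <- s) F i) = \sum_(i <- s) amul a (F i).
Proof. exact: (big_morph _ (amulDr a) (amul0r a)). Qed.

Lemma amul_suml (I : Type) (s : seq I) (F : I -> A) a :
  amul (\sum_(i <- s) F i) a = \sum_(i <- s) amul (F i) a.
Proof. exact: (big_morph (amul^~ a) (fun x y => amulDl x y a) (amul0l a)). Qed.

Lemma astarB a b : astar (a - b) = astar a - astar b.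
Proof. by rewrite astarD -[- b]scaleN1r astarZ rmorphN1 scaleN1r. Qed.

Lemma astar0 : astar (0 : A) = 0.
Proof. by have := astarZ 0 (0 : A); rewrite rmorph0 !scale0r. Qed.

Lemma astar_sum (I : Type) (s : seq I) (F : I -> A) :
  astar (\sum_(i <- s) F i) = \sum_(i <- s) astar (F i).
Proof. exact: (big_morph _ astarD astar0). Qed.

Lemma ler_rnorm_amul a b : rnorm (amul a b) <= rnorm a * rnorm b.
Proof. by have := ler_norm_amul a b; rewrite !rnormE -rmorphM lecR. Qed.

Lemma rnorm_astar_amul a : rnorm (amul (astar a) a) = rnorm a ^+ 2.
Proof. by have := norm_astar_amul a; rewrite !rnormE -rmorphXn => /complexI. Qed.

Lemma rnorm_astar a : rnorm (astar a) = rnorm a.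
Proof.
have le b : rnorm b <= rnorm (astar b).
  have [->|b0] := eqVneq b 0; first by rewrite rnorm0 rnorm_ge0.
  rewrite -(ler_pM2r (rnorm_gt0 b0)) -expr2 -rnorm_astar_amul.
  exact: ler_rnorm_amul.
by apply/eqP; rewrite eq_le le -{2}(astarK a) le.
Qed.

Lemma astar_amul_eq0 a : amul (astar a) a = 0 -> a = 0.
Proof.
move=> h; apply: rnorm_eq0; apply/eqP.
by rewrite -(sqrf_eq0 (rnorm a)) -rnorm_astar_amul h rnorm0.
Qed.

Lemma selfadj_sqr_eq0 h : astar h = h -> amul h h = 0 -> h = 0.
Proof. by move=> hh; rewrite -{1}hh; exact: astar_amul_eq0. Qed.

Lemma cvg_rnormP (u : nat -> A) (l : A) :
  u @ \oo --> l <-> (fun n => rnorm (u n - l)) @ \oo --> (0 : R).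
Proof.
rewrite (cvg0_seqP (fun n => rnorm_ge0 _)); split.
  move=> /cvgrPdist_lt h e e0; have [|N _ hN] := h e%:C%C; first by rewrite ltcR.
  by exists N => n Nn; rewrite rnorm_distC -ltcR -rnormE; exact: hN.
move=> h; apply/cvgrPdist_lt => e e0.
have eE : e = (complex.Re e)%:C%C by rewrite RRe_real // gtr0_real.
have [|N hN] := h (complex.Re e); first by rewrite -ltcR -eE.
by exists N => // n Nn; rewrite distrC rnormE eE ltcR; exact: hN.
Qed.

(** This is the power with exponent [n + 1]: the algebra may have no unit, so exponents are shifted
    by one. *)
Definition apow h n := iter n (amul h) h.

Lemma apowD h m n : amul (apow h m) (apow h n) = apow h (m + n).+1.
Proof. by elim: m => //= m IH; rewrite -amulA IH. Qed.

Lemma astar_apow h n : astar h = h -> astar (apow h n) = apow h n.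
Proof.
move=> hh; elim: n => //= n IH; rewrite astarM IH hh.
by rewrite -[h in LHS]/(apow h 0) apowD addn0.
Qed.

Lemma amul_apow_eq0 h n z : amul h z = 0 -> amul (apow h n) z = 0.
Proof. by move=> hz; elim: n => //= n IH; rewrite -amulA IH amul0r. Qed.

Lemma rnorm_apow_le h n : rnorm h <= 1 -> rnorm (apow h n) <= 1.
Proof.
move=> h1; elim: n => //= n IH; apply: le_trans (ler_rnorm_amul _ _) _.
by apply: mulr_ile1 => //; exact: rnorm_ge0.
Qed.

(** The C*-identity gives norm 1 for exponents [2 ^ k]. Any power is a factor of such a one, and the
    other factor has norm at most 1. *)
Lemma rnorm_apow h n : astar h = h -> rnorm h = 1 -> rnorm (apow h n) = 1.
Proof.
move=> hh h1; have le1 m : rnorm (apow h m) <= 1 by apply: rnorm_apow_le; rewrite h1.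
have pow2 k : rnorm (apow h (2 ^ k).-1) = 1.
  elim: k => //= k IH; have k0 : (0 < 2 ^ k)%N by rewrite expn_gt0.
  have -> : (2 ^ k.+1).-1 = ((2 ^ k).-1 + (2 ^ k).-1).+1.
    by rewrite expnS mul2n -addnn -{1 2}(prednK k0) addSn addnS.
  by rewrite -apowD -{1}(astar_apow _ hh) rnorm_astar_amul IH expr1n.
have lt : (n.+1 <= (2 ^ n.+1).-1)%N.
  by rewrite -ltnS prednK ?expn_gt0 // ltn_expl.
apply/eqP; rewrite eq_le le1 /= -(pow2 n.+1) -(subnKC lt) addSn -apowD.
by apply: le_trans (ler_rnorm_amul _ _) _; rewrite ler_piMr ?rnorm_ge0.
Qed.

(* The squares [h i * h i] satisfy the same hypotheses, so that the norm [N] of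
   the sum satisfies [N ^ (2 ^ k) <= n] for every [k]. *)
Lemma orthogonal_sum_rnorm (h : nat -> A) n : (forall i, astar (h i) = h i) ->
  (forall i j, i != j -> amul (h i) (h j) = 0) -> (forall i, rnorm (h i) <= 1) ->
  rnorm (\sum_(i < n) h i) <= 1.
Proof.
move=> hs ho h1.
have pow2 k : forall h : nat -> A, (forall i, astar (h i) = h i) ->
    (forall i j, i != j -> amul (h i) (h j) = 0) ->
    (forall i, rnorm (h i) <= 1) ->
    rnorm (\sum_(i < n) h i) ^+ (2 ^ k) <= n%:R.
  elim: k => [|k IH] g gs go g1.
    rewrite expr1; apply: le_trans (ler_rnorm_sum _ _) _.
    rewrite -[n in leRHS]card_ord -sumr_const.
    by apply: ler_sum => i _; exact: g1.
  rewrite expnS exprM -rnorm_astar_amul astar_sum.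
  have -> : amul (\sum_(i < n) astar (g i)) (\sum_(i < n) g i)
      = \sum_(i < n) amul (g i) (g i).
    rewrite amul_suml; apply: eq_bigr => i _; rewrite amul_sumr gs (bigD1 i) //=.
    by rewrite big1 ?addr0 // => j ji; apply: go; rewrite eq_sym.
  apply: (IH (fun i => amul (g i) (g i))) => [i|i j ij|i].
  - by rewrite astarM gs.
  - by rewrite amulA -[amul (amul (g i) _) (g j)]amulA go // amul0r amul0l.
  - by apply: le_trans (ler_rnorm_amul _ _) _; rewrite mulr_ile1 ?rnorm_ge0.
set N := rnorm _; rewrite leNgt; apply/negP => N1.
have bern m : 1 + m%:R * (N - 1) <= N ^+ m.
  elim: m => [|m IH]; first by rewrite mul0r addr0.
  rewrite exprS; apply: le_trans (ler_wpM2l (ltW (lt_trans ltr01 N1)) IH).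
  rewrite -natr1; have := ler0n R m; have := sqr_ge0 (N - 1).
  have N0 : 0 <= N - 1 by rewrite subr_ge0 ltW.
  by have := mulr_ge0 (ler0n R m) (sqr_ge0 (N - 1)); lra.
have N0 : 0 < N - 1 by rewrite subr_gt0.
(* Since [2 ^ k > k], Bernoulli's inequality makes [N ^+ (2 ^ k)] exceed [n] for this [k]. *)
pose k := Num.bound (n%:R / (N - 1)).
have : n%:R / (N - 1) < k%:R.
  by apply: le_lt_trans (archi_boundP _); rewrite ?ler_norm // divr_ge0 // ltW.
rewrite ltr_pdivrMr // ltNge => /negP; apply.
apply: le_trans (pow2 k h hs ho h1); rewrite -/N.
apply: le_trans (bern _); rewrite -[leLHS]add0r lerD // ler_pM2r // ler_nat.
exact/ltnW/ltn_expl.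
Qed.

Lemma fdim_astar (W : A -> Prop) : fdim W -> fdim (fun z => W (astar z)).
Proof.
move=> [s hs]; exists (map astar s) => v /hs; rewrite -[v in X in _ -> X]astarK.
move: (astar v) => {hs} {}v; elim: s v => [|g s IH] v /=.
  by move=> ->; rewrite astar0.
by move=> [k /IH hk]; exists k^*; rewrite -astarZ -astarB.
Qed.

(* A cluster point [v] of the powers of [h] is fixed by a cluster point [e] of
   their quotients, and [h] is bounded below on the fixed space of [e]. *)
Lemma apow_cluster h : astar h = h -> rnorm h = 1 ->
  (forall a : nat -> A, (forall n, rnorm (a n) <= 1) ->
     exists phi l, {homo phi : m n / (m < n)%N} /\
       (fun n => rnorm (amul h (a (phi n)) - l)) @ \oo --> (0 : R)) ->
  exists v, [/\ v != 0, astar v = v, fdim (fun z => exists a, z = amul v a) &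
    exists nu, (fun n => rnorm (apow h (nu n) - v)) @ \oo --> (0 : R)].
Proof.
move=> hh h1 hcpt.
have le0 (c : R) (u : nat -> R) : (forall n, c <= u n) -> u @ \oo --> (0 : R) -> c <= 0.
  move=> cu u0; rewrite -(cvg_lim _ u0) //; apply: limr_ge; first exact: cvgP u0.
  exact: nearW.
have apow1 n : rnorm (apow h n) = 1 by exact: rnorm_apow.
have [n|phi [v [hphi phiv]]] := hcpt (apow h); first by rewrite apow1.
(* The shift by one is the factor [h] supplied by the compactness hypothesis; keeping every second
   term leaves gaps of at least 2 between exponents. *)
pose nu j := (phi (2 * j)%N).+1.
have nuv : (fun n => rnorm (apow h (nu n) - v)) @ \oo --> (0 : R).
  apply: (@cvg_subseq _ _ _ (fun j => 2 * j)%N) phiv.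
  by move=> m n mn; rewrite ltn_pmul2l.
have nuS j : (nu j + 2 <= nu j.+1)%N.
  rewrite /nu addSn ltnS addn2 mulnS add2n.
  apply: leq_trans (hphi _ _ (ltnSn _)); rewrite ltnS; exact: hphi.
have [n|psi [e [hpsi psie]]] := hcpt (fun j => apow h (nu j.+1 - (nu j + 2))).
  by rewrite apow1.
(* [E j] is the quotient of two consecutive selected powers; the gap of at least 2 makes it [h]
   times another power, so compactness applies. *)
pose E j := apow h (nu (psi j).+1 - (nu (psi j) + 2)).+1.
have {}psie : (fun n => rnorm (E n - e)) @ \oo --> (0 : R) by exact: psie.
have E_nu j : amul (E j) (apow h (nu (psi j))) = apow h (nu (psi j).+1).
  rewrite apowD; congr apow; have := nuS (psi j).
  move: (nu (psi j)) (nu _) => a b ab.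
  by rewrite addSn -addn2 -addnA subnK.
have nuvpsi := cvg_subseq hpsi nuv.
have nuvS : (fun n => rnorm (apow h (nu (psi n).+1) - v)) @ \oo --> (0 : R).
  by apply: (@cvg_subseq _ _ _ (fun j => (psi j).+1)) nuv => m n mn; rewrite ltnS hpsi.
(* Pass to the limit in [E_nu]. *)
have ev : amul e v = v.
  apply/eqP; rewrite -subr_eq0; apply/eqP/rnorm_eq0/eqP.
  rewrite eq_le rnorm_ge0 andbT.
  apply: (le0 _ (fun n => rnorm v * rnorm (E n - e) +
    (rnorm (apow h (nu (psi n)) - v) + rnorm (apow h (nu (psi n).+1) - v)))).
    move=> n; apply: le_trans (ler_rnorm_dist _ (amul (E n) v) _) _.
    apply: lerD.
      by rewrite -amulBl mulrC (rnorm_distC (E n)); exact: ler_rnorm_amul.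
    apply: le_trans (ler_rnorm_dist _ (apow h (nu (psi n).+1)) _) _.
    rewrite lerD2r -E_nu -amulBr (rnorm_distC _ v).
    by apply: le_trans (ler_rnorm_amul _ _) _; rewrite apow1 mul1r.
  apply: cvg0D; first exact: cvg0Ml.
  by apply: cvg0D => //.
exists v; split; last by exists nu.
- apply/eqP => v0; have : (1 : R) <= 0; last by rewrite ler10.
  by apply: le0 nuv => n; rewrite v0 subr0 apow1.
- apply/eqP; rewrite -subr_eq0; apply/eqP/rnorm_eq0/eqP.
  rewrite eq_le rnorm_ge0 andbT.
  apply: le0 (cvg0D nuv nuv) => n.
  rewrite -{1}(rnorm_astar (apow h (nu n) - v)) astarB astar_apow //.
  rewrite (rnorm_distC _ (astar v)).
  exact: ler_rnorm_dist.
have : fdim (fun a => amul e a = a).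
  apply: (@compact_bounded_below_fdim _ _ _ (amul h) 2^-1) => //.
  - split; first by rewrite amul0r.
    by move=> k x y ex ey; rewrite amulDr amulZr ex ey.
  - exact: amulBr.
  (* If [E N] is within 1/2 of [e] and [e] fixes [a], the norm of [a] is at most that of
     [amul (E N) a] plus half its own; and [E N] is a power of norm 1 times [h]. *)
  move=> a ea; have /cvg_seqP/(_ 2^-1)[|N hN] := psie; first by rewrite invr_gt0.
  have := hN N (leqnn N); rewrite subr0 ger0_norm ?rnorm_ge0 // => /ltW{}hN.
  have h2 : rnorm (amul (E N) a) <= rnorm (amul h a).
    have -> : E N = amul (apow h (nu (psi N).+1 - (nu (psi N) + 2))) (apow h 0).
      by rewrite apowD addn0.
    rewrite -amulA.
    by apply: le_trans (ler_rnorm_amul _ _) _; rewrite apow1 mul1r.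
  have := ler_rnorm_dist (amul e a) (amul (E N) a) 0; rewrite !subr0 {1}ea.
  have := ler_rnorm_amul (E N - e) a; rewrite amulBl rnorm_distC.
  have : rnorm (E N - e) * rnorm a <= 2^-1 * rnorm a by rewrite ler_wpM2r ?rnorm_ge0.
  lra.
by apply: fdim_sub => _ [a ->]; rewrite amulA ev.
Qed.

(** Each condition [amul a z = 0] defines the kernel of a linear map with finite dimensional image,
    so the common kernel has finite codimension. *)
Lemma annihilator_neq0 (s : seq A) : ~ fdim (fun _ : A => True) ->
  {in s, forall z, fdim (fun c => exists a, c = amul a z)} ->
  exists2 a, a != 0 & {in s, forall z, amul a z = 0}.
Proof.
move=> nA hs.
have : ~ fdim (fun a => {in s, forall z, amul a z = 0}).
  elim: s hs => [|g s IH] hs; first by apply: contra_not nA; apply: fdim_sub.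
  have [t ht] := hs g (mem_head _ _).
  have nIH := IH (fun z zs => hs z (mem_behead (s := g :: s) zs)).
  apply: contra_not nIH => fd; apply: (@fdim_ker_image _ _ _ (amul^~ g) t).
  - by move=> a x y; rewrite amulDl amulZl.
  - split; first by move=> z _; rewrite amul0l.
    by move=> a x y hx hy z zs; rewrite amulDl amulZl hx // hy // scaler0 addr0.
  - by move=> v _; apply: ht; exists v.
  by apply: fdim_sub fd => v [v1 v2] z; rewrite inE => /predU1P[->//|]; exact: v1.
apply: contra_notP => h; exists [::] => a ha /=; apply/eqP/negP => /negP a0.
by apply: h; exists a.
Qed.

(** Since [A q] is spanned by finitely many [z = b q], killing it amounts to finitely many
    conditions [amul a z = 0], and each [A z] lies in [A q]. *)
Lemma ideal_annihilator_neq0 (s : seq A) : ~ fdim (fun _ : A => True) ->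
  {in s, forall q, fdim (fun z => exists a, z = amul a q)} ->
  exists2 a, a != 0 & {in s, forall q b, amul a (amul b q) = 0}.
Proof.
move=> nA hs.
have [T hT hTs] : exists2 T : seq A,
    {in T, forall z, fdim (fun c => exists a, c = amul a z)} &
    forall a, {in T, forall z, amul a z = 0} ->
      {in s, forall q b, amul a (amul b q) = 0}.
  elim: s hs => [|q s IH] hs; first by exists [::].
  have [|T hT hTs] := IH; first by move=> z zs; apply: hs; rewrite inE zs orbT.
  have [t ht] := hs q (mem_head _ _).
  have [||u uq hu] := @subspace_basis _ _ (fun z => exists a, z = amul a q) t.
  - split; first by exists 0; rewrite amul0l.
    by move=> k _ _ [x ->] [y ->]; exists (k *: x + y); rewrite amulDl amulZl.
  - exact: ht.
  exists (u ++ T) => [z|a ha p].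
    rewrite mem_cat => /orP[/uq[b ->]|]; last exact: hT.
    by apply: fdim_sub (hs q (mem_head _ _)) => _ [a ->]; exists (amul a b); rewrite amulA.
  rewrite inE => /predU1P[->|ps] b; last first.
    by apply: hTs => // z zT; apply: ha; rewrite mem_cat zT orbT.
  apply: (@lspan_least _ _ (fun z => amul a z = 0) u); last by apply: hu; exists b.
  - split; first by rewrite amul0r.
    by move=> k x y hx hy; rewrite amulDr amulZr hx hy scaler0 addr0.
  - by move=> z zu; apply: ha; rewrite mem_cat zu.
by have [a a0 ha] := annihilator_neq0 nA hT; exists a => //; exact: hTs.
Qed.

End CStarBasics.

(** * Algebra of the inner product of a module *)

Section HilbertModules.
Variables (R : realType) (A : cstarAlgType R) (M : preHilbertModType A).
Implicit Types (a b : A) (x y z : M) (k : R[i]).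

Lemma inner_addl x y z : inner (x + y) z = inner x z + inner y z.
Proof. by rewrite -[x]scale1r inner_linear !scale1r. Qed.

Lemma inner0l y : inner (0 : M) y = 0.
Proof. by apply: (addrI (inner 0 y)); rewrite -inner_addl !addr0. Qed.

Lemma inner_scalel k x y : inner (k *: x) y = k *: inner x y.
Proof. by rewrite -[k *: x]addr0 inner_linear inner0l addr0. Qed.

Lemma inner_addr x y z : inner z (x + y) = inner z x + inner z y.
Proof. by rewrite -inner_star inner_addl astarD !inner_star. Qed.

Lemma inner_scaler k x y : inner x (k *: y) = k^* *: inner x y.
Proof. by rewrite -inner_star inner_scalel astarZ inner_star. Qed.

Lemma inner_actr a x y : inner x (act a y) = amul (inner x y) (astar a).
Proof. by rewrite -inner_star inner_act astarM inner_star. Qed.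

Lemma inner_subl x y z : inner (x - y) z = inner x z - inner y z.
Proof. by rewrite inner_addl -scaleN1r inner_scalel scaleN1r. Qed.

Lemma inner_suml (I : Type) (s : seq I) (F : I -> M) y :
  inner (\sum_(i <- s) F i) y = \sum_(i <- s) inner (F i) y.
Proof. exact: (big_morph (inner^~ y) (fun x z => inner_addl x z y) (inner0l y)). Qed.

Lemma inner0r y : inner y (0 : M) = 0.
Proof. by rewrite -inner_star inner0l astar0. Qed.

Lemma inner_sumr (I : Type) (s : seq I) (F : I -> M) y :
  inner y (\sum_(i <- s) F i) = \sum_(i <- s) inner y (F i).
Proof. exact: (big_morph (inner y) (fun x z => inner_addr x z y) (inner0r y)). Qed.

Lemma hnormE x : hnorm x = (Num.sqrt (rnorm (inner x x)))%:C%C.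
Proof.
rewrite /hnorm rnormE -{1}(sqr_sqrtr (rnorm_ge0 (inner x x))) rmorphXn.
by rewrite sqrCK // ler0c sqrtr_ge0.
Qed.

Lemma hnorm_boundedP (x : nat -> M) : hnorm_bounded x <->
  exists B : R, forall n, rnorm (inner (x n) (x n)) <= B.
Proof.
split=> [[B hB]|[B hB]].
  have B0 : 0 <= B by apply: le_trans (hB 0%N); rewrite hnormE ler0c sqrtr_ge0.
  have BE : B = (complex.Re B)%:C%C by rewrite RRe_real // ger0_real.
  exists (complex.Re B ^+ 2) => n; have := hB n; rewrite BE hnormE lecR => h.
  rewrite -(sqr_sqrtr (rnorm_ge0 _)) ler_pXn2r ?nnegrE ?sqrtr_ge0 //.
  by rewrite -ler0c -BE.
exists (Num.sqrt B)%:C%C => n; rewrite hnormE lecR; exact: ler_wsqrtr.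
Qed.

End HilbertModules.

(** * Condition [H] forces finite dimension *)

Section ForwardDirection.
Variables (R : realType) (A : cstarAlgType R) (M : hilbertModType A).
Implicit Types (a b h q : A) (x y : M).

(** If every [<x,y>] killed [a], so would the dense span, hence also [astar a], forcing [a = 0]. *)
Lemma full_amul_neq0 a : full M -> a != 0 ->
  exists x y : M, amul (inner x y) a != 0.
Proof.
move=> hfull /eqP a0; apply: contrapT => h; apply: a0; apply: astar_amul_eq0.
have {}h x y : amul (inner x y : A) a = 0.
  by apply/eqP/negP => /negP xy; apply: h; exists x, y.
apply: rnorm_eq0; apply/eqP; rewrite eq_le rnorm_ge0 andbT.
apply/ler_addgt0Pr => e e0; rewrite add0r.
pose d := e / (rnorm a + 1).
have a1 : 0 < rnorm a + 1 by rewrite ltr_wpDl ?rnorm_ge0.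
have d0 : 0 < d by rewrite divr_gt0.
have [||s [ds [n [c [w [ws sE]]]]]] := hfull (ball (astar a) d%:C%C).
- by exists (astar a); apply: ballxx; rewrite ltcR.
- by apply: ball_open; rewrite ltcR.
have sa0 : amul s a = 0.
  rewrite sE amul_suml big1 // => i _; rewrite amulZl.
  by have [x [y ->]] := ws i; rewrite h scaler0.
rewrite -[amul _ _]subr0 -sa0 -amulBl.
apply: le_trans (ler_rnorm_amul _ _) _.
have : rnorm (astar a - s) < d.
  by move: ds; rewrite -ball_normE /= rnormE ltcR.
move=> /ltW /(ler_wpM2r (rnorm_ge0 a)) /le_trans; apply.
rewrite /d mulrAC ler_pdivrMr //; apply: ler_wpM2l; first exact: ltW.
by rewrite lerDl.
Qed.

(** Apply [H] to the bounded sequence [act (a n) x], using [<a x, w> = a <x,w>]. *)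
Lemma condition_H_compact : condition_H M ->
  forall (x w : M) (a : nat -> A), (forall n, rnorm (a n) <= 1) ->
  exists phi l, {homo phi : m n / (m < n)%N} /\
    (fun n => rnorm (amul (a (phi n)) (inner x w) - l)) @ \oo --> (0 : R).
Proof.
move=> H x w a a1.
have [|phi [x0 [hphi cvgH]]] := H (fun n => act (a n) x).
  apply/hnorm_boundedP; exists (rnorm (inner x x : A)) => n.
  rewrite inner_act inner_actr; apply: le_trans (ler_rnorm_amul _ _) _.
  apply: le_trans (ler_piMl (rnorm_ge0 _) (a1 n)) _.
  apply: le_trans (ler_rnorm_amul _ _) _.
  by rewrite ler_piMr ?rnorm_ge0 // rnorm_astar.
exists phi, (inner x0 w); split=> //.
by under eq_fun do rewrite -inner_act; apply/cvg_rnormP; exact: cvgH.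
Qed.

(** [h] is the normalised square [<x,w>^* <x,w>], rewritten as [<x',w>] so that multiplication by it
    is compact. As [<x,w>] ends in the factor [a], [h] kills every [A q], and so does the limit [v]
    of its powers. *)
Lemma condition_H_fdim_right_ideal a (s : seq A) :
  full M -> condition_H M -> a != 0 -> {in s, forall q b, amul a (amul b q) = 0} ->
  exists v, [/\ v != 0, astar v = v, fdim (fun z => exists b, z = amul v b) &
    {in s, forall q b, amul v (amul b q) = 0}].
Proof.
move=> hfull H a0 aq; have [x [y xya0]] := full_amul_neq0 hfull a0.
pose w := act (astar a) y.
have xw : inner x w = amul (inner x y) a by rewrite /w inner_actr astarK.
have g0 : amul (inner w x : A) (inner x w) != 0.
  apply: contra_neq xya0 => h; rewrite -xw; apply: astar_amul_eq0.
  by rewrite inner_star.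
pose c := (rnorm (amul (inner w x : A) (inner x w)))^-1.
have c0 : 0 <= c by rewrite invr_ge0 rnorm_ge0.
pose x' := act (c%:C%C *: inner w x : A) x.
pose h : A := inner x' w.
have hE : h = c%:C%C *: amul (inner w x) (inner x w) by rewrite /h inner_act amulZl.
have hh : astar h = h.
  rewrite hE astarZ astarM !inner_star; congr (_ *: _).
  exact: conjc_real.
have h1 : rnorm h = 1.
  by rewrite hE rnormZ rnorm_real ger0_norm // mulVf // gt_eqF // rnorm_gt0.
have [u hu|v [v0 vv vfd [nu nuv]]] := apow_cluster hh h1.
  (* The involution turns compactness of right multiplication by [h] into that of left
     multiplication. *)
  have [|phi [l [hphi hl]]] := @condition_H_compact H x' w (fun n => astar (u n)).
    by move=> n; rewrite rnorm_astar.
  exists phi, (astar l); split=> //.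
  by under eq_fun do rewrite -rnorm_astar astarB astarM hh astarK.
exists v; split=> // q qs b.
have hz : amul h (amul b q) = 0.
  by rewrite hE amulZl xw -!amulA aq // !amul0r scaler0.
apply: rnorm_eq0; apply/eqP; rewrite eq_le rnorm_ge0 andbT.
have := cvg0Ml (rnorm (amul b q)) nuv => lim0.
rewrite -(cvg_lim _ lim0) //; apply: limr_ge; first exact: cvgP lim0.
apply: nearW => n; rewrite mulrC.
apply: le_trans (ler_rnorm_amul _ _).
by rewrite amulBl amul_apow_eq0 // sub0r rnormN.
Qed.

Lemma condition_H_finite_dimensional :
  full M -> condition_H M -> finite_dimensional A.
Proof.
move=> hfull H; apply: fdim_finite_dimensional; apply: contrapT => nA.
pose G q := [/\ q != 0, astar q = q & fdim (fun z => exists a, z = amul a q)].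
have [s sG|q qP] := @history_choice A G
    (fun s v => {in s, forall q b, amul v (amul b q) = 0}).
  have [|a a0 ha] := @ideal_annihilator_neq0 _ _ s nA; first by move=> q /sG[].
  have [v [v0 vv vfd vs]] := condition_H_fdim_right_ideal hfull H a0 ha.
  exists v => //; split=> //; apply: fdim_sub (fdim_astar vfd) => _ [b ->].
  by exists (astar b); rewrite astarM vv.
have qG i : G (q i) by exact: (qP i).1.
have qs i : astar (q i) = q i by case: (qG i).
have qlt i j : (i < j)%N -> forall b, amul (q j) (amul b (q i)) = 0.
  move=> ij; apply: (qP j).2; apply/mapP; exists i => //.
  by rewrite mem_iota.
(* The case [i < j] follows from [qlt] by taking adjoints. *)
have qo i j : i != j -> forall b, amul (q i) (amul b (q j)) = 0.
  rewrite neq_ltn => /orP[ij|/qlt//] b.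
  by apply: (can_inj astarK); rewrite astar0 !astarM !qs -amulA qlt.
have /choice[y yP] : forall i, exists y : M,
    rnorm (inner (act (q i) y) (act (q i) y) : A) = 1.
  move=> i; have [qi0 _ _] := qG i.
  have [x [y xy]] := full_amul_neq0 hfull qi0.
  have n0 : 0 < rnorm (inner (act (q i) y) (act (q i) y) : A).
    apply: rnorm_gt0; apply: contra_neq xy => /inner_eq0 qy.
    by rewrite -[q i]qs -inner_actr qy inner0r.
  set N := rnorm _ in n0; pose c := (Num.sqrt N)^-1.
  exists (c%:C%C *: y); rewrite -actZr inner_scalel inner_scaler scalerA rnormZ -/N.
  rewrite [_^*]conjc_real -rmorphM rnorm_real ger0_norm; last first.
    by rewrite mulr_ge0 // invr_ge0 sqrtr_ge0.
  by rewrite /c -invfM -expr2 sqr_sqrtr ?ltW // mulVf ?gt_eqF.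
pose x i := act (q i) (y i).
have xo i j : i != j -> inner (x i) (x j) = 0 :> A.
  by move=> ij; rewrite /x inner_act inner_actr qs qo.
pose h i : A := inner (x i) (x i).
have hs i : astar (h i) = h i by exact: inner_star.
have ho i j : i != j -> amul (h i) (h j) = 0.
  move=> ij; have hE k : h k = amul (q k) (amul (inner (y k) (y k)) (q k)).
    by rewrite /h /x inner_act inner_actr qs.
  by rewrite !hE -!amulA (amulA (q j)) qo // !amul0r.
have h1 i : rnorm (h i) = 1 by exact: yP.
pose S n := \sum_(i < n) x i.
have Sx n j : inner (S n) (x j) = if (j < n)%N then h j else 0 :> A.
  rewrite /S inner_suml; case: ifP => jn.
    rewrite (bigD1 (Ordinal jn)) //= big1 ?addr0 // => i ij.
    by apply: xo; rewrite -val_eqE in ij.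
  rewrite big1 // => i _; apply: xo; apply: contraFneq jn => <-; exact: ltn_ord.
have SS n : inner (S n) (S n) = \sum_(i < n) h i :> A.
  rewrite {2}/S inner_sumr; apply: eq_bigr => i _; by rewrite Sx ltn_ord.
have [|phi [s0 [hphi cvgS]]] := H S.
  apply/hnorm_boundedP; exists 1 => n; rewrite SS.
  by apply: orthogonal_sum_rnorm => // i; rewrite h1.
(* The products with [x j] are constantly [h j] once [j < phi n], which holds for [n > j] because
   [phi n >= n]. *)
have s0x j : inner s0 (x j) = h j :> A.
  have /cvg_rnormP/cvg_seqP hj := cvgS (x j).
  apply/eqP; rewrite eq_sym -subr_eq0; apply/eqP/rnorm_eq0/eqP.
  rewrite eq_le rnorm_ge0 andbT; apply/ler_addgt0Pr => e /hj[N hN].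
  have := hN (maxn N j.+1) (leq_maxl _ _).
  rewrite subr0 ger0_norm ?rnorm_ge0 // Sx (leq_trans (leq_maxr N _)) ?leq_homo_ltn //.
  by rewrite add0r => /ltW.
(* Multiplication by [h j] isolates one term of the sum of the [h i]. *)
have Ss0 n j : amul (h j) (inner (S n) s0) = if (j < n)%N then amul (h j) (h j) else 0.
  rewrite /S inner_suml amul_sumr.
  have -> : \sum_(i < n) amul (h j) (inner (x i) s0 : A) =
      \sum_(i < n) amul (h j) (h i).
    by apply: eq_bigr => i _; rewrite -[inner (x i) _]inner_star s0x hs.
  case: ifP => jn.
    rewrite (bigD1 (Ordinal jn)) //= big1 ?addr0 // => i ij.
    by apply: ho; rewrite eq_sym -val_eqE in ij *.
  rewrite big1 // => i _; apply: ho; apply: contraFneq jn => ->; exact: ltn_ord.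
have /cvg_rnormP/cvg_seqP/(_ 2^-1)[|N hN] := cvgS s0; first by rewrite invr_gt0.
have := hN N (leqnn N); have := hN N.+1 (leqnSn N).
rewrite !subr0 !ger0_norm ?rnorm_ge0 // => hN1 hN2.
(* With [j = phi N] the product is the square of [h (phi N)], of norm 1, although both inner
   products lie within 1/2 of the same limit. *)
have := ler_rnorm_amul (h (phi N)) (inner (S (phi N.+1)) s0 - inner (S (phi N)) s0).
rewrite amulBr !Ss0 ltnn hphi // subr0 -{1}hs rnorm_astar_amul h1.
have := ler_rnorm_dist (inner (S (phi N.+1)) s0 : A) (inner s0 s0) (inner (S (phi N)) s0).
rewrite (rnorm_distC (inner s0 s0)); lra.
Qed.

End ForwardDirection.

(** * Coordinates on finite dimensional spaces *)

Section Bases.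
Variables (K : fieldType) (V : lmodType K).

(** A basis is encoded as an injective linear map from row vectors. A generator outside the image of
    [f] adds a coordinate; one inside is discarded. *)
Lemma lspan_basis (s : seq V) : exists n (f : 'rV[K]_n -> V),
  [/\ forall a u w, f (a *: u + w) = a *: f u + f w, injective f &
      forall v, lspan s v -> exists u, f u = v].
Proof.
elim: s => [|g s [n [f [flin finj fs]]]].
  exists 0%N, (fun=> 0); split=> [a u w|u w _|v ->]; first by rewrite scaler0 addr0.
    by rewrite !thinmx0.
  by exists 0.
have [[u0 fu0]|gf] := pselect (exists u, f u = g).
  exists n, f; split=> // v [k /fs[u fu]]; exists (k *: u0 + u).
  by rewrite flin fu fu0 addrC subrK.
pose F (u : 'rV_(1 + n)) := lsubmx u 0 0 *: g + f (rsubmx u).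
have Flin a u w : F (a *: u + w) = a *: F u + F w.
  by rewrite /F [lsubmx _]linearP [rsubmx _]linearP /= flin !mxE scalerDr scalerDl scalerA addrACA.
exists (1 + n)%N, F; split=> // [u w Fuw|v [k /fs[u fu]]]; last first.
  by exists (row_mx k%:M u); rewrite /F row_mxKl row_mxKr fu mxE mulr1n addrC subrK.
have f0 : f 0 = 0.
  by apply: (addrI (f 0)); rewrite -{1}[f 0]scale1r -flin scaler0 !addr0.
apply/eqP; rewrite -subr_eq0; apply/eqP.
have : F (u - w) = 0 by rewrite addrC -scaleN1r Flin Fuw scaleN1r addrC subrr.
move: (u - w) => {Fuw w}u; rewrite /F => Fu.
have u0 : lsubmx u 0 0 = 0.
  apply: contra_notP gf => /eqP u0; exists (- (lsubmx u 0 0)^-1 *: rsubmx u).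
  rewrite -[X in f X]addr0 flin f0 addr0; move/eqP: Fu; rewrite addr_eq0 => /eqP Fu.
  by apply: (scalerI u0); rewrite Fu scalerA mulrN divff // scaleN1r.
rewrite -[u]hsubmxK; rewrite u0 scale0r add0r -[RHS]f0 in Fu; rewrite (finj _ _ Fu).
rewrite (_ : lsubmx u = 0) ?row_mx0 //.
by apply/matrixP => i j; rewrite !ord1 u0 mxE.
Qed.

Lemma finite_dimensional_basis : finite_dimensional V ->
  exists n (f : 'rV[K]_n -> V) (c : V -> 'rV[K]_n),
  [/\ forall a u w, f (a *: u + w) = a *: f u + f w, cancel f c & cancel c f].
Proof.
move=> [S [/finite_seqP[s ->] sT]].
have hs v : lspan s v.
  have : linear_span [set` s] v by rewrite sT.
  move=> [n [k [w [ws ->]]]]; have [s0 sD] := lspan_subspace s.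
  elim/big_ind: _ => // [x y|i _]; first by apply: subspaceD.
  by apply: subspaceZ => //; apply: mem_lspan; exact: ws.
have [n [f [flin finj fs]]] := lspan_basis s.
have /choice[c cK] := fun v => fs v (hs v).
by exists n, f, c; split=> // u; apply: finj.
Qed.

End Bases.

(** * Triangular forms, traces and eigenvalues *)

Section Triangular.
Variables (C : numClosedFieldType) (n : nat).
Implicit Types M T P : 'M[C]_n.

Lemma trig_form M : exists P T,
  [/\ P \in unitmx, P *m M = T *m P & is_trig_mx T].
Proof.
have [|P Pu] := @cotrigonalization C n [:: M].
  by move=> ? ?; rewrite !inE => /eqP-> /eqP->.
rewrite /= andbT => trig; have Punit := unitarymx_unit Pu.
exists P, (conjmx P M); split=> //.
by rewrite conjumx // mulmxKV.
Qed.

Lemma mxtrace_sim M T P : P \in unitmx -> P *m M = T *m P -> \tr M = \tr T.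
Proof.
move=> Pu PM; have -> : M = invmx P *m (T *m P) by rewrite -PM mulKmx.
by rewrite mxtrace_mulC -mulmxA mulmxV // mulmx1.
Qed.

Lemma mxtrace_trig_sqr T : is_trig_mx T -> \tr (T *m T) = \sum_i T i i ^+ 2.
Proof.
move=> /is_trig_mxP hT; apply: eq_bigr => i _.
rewrite mxE (bigD1 i) //= big1 ?addr0 // => j; rewrite neq_ltn => /orP[ji|ij].
  by rewrite (hT j i) // mulr0.
by rewrite (hT i j) // mul0r.
Qed.

Lemma trig_eigenvalue M T P i : P \in unitmx -> P *m M = T *m P ->
  is_trig_mx T -> eigenvalue M (T i i).
Proof.
move=> Pu PM trig; have : eigenvalue T (T i i).
  rewrite eigenvalue_root_char char_poly_trig // rootE horner_prod.
  by apply/prodf_eq0; exists i; rewrite // hornerXsubC subrr.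
move=> /eigenvalueP[v vT v0]; apply/eigenvalueP; exists (v *m P).
  by rewrite -mulmxA PM mulmxA vT -scalemxAl.
by apply: contraNneq v0 => vP; rewrite -[v](mulmxK Pu) vP mul0mx.
Qed.

End Triangular.

(** * The trace of left multiplication *)

Section Trace.
Variables (R : realType) (A : cstarAlgType R) (n : nat).
Variables (f : 'rV[R[i]]_n -> A) (c : A -> 'rV[R[i]]_n).
Hypothesis f_linear : forall k u w, f (k *: u + w) = k *: f u + f w.
Hypotheses (fK : cancel f c) (cK : cancel c f).
Implicit Types (a b h x : A) (z : R[i]).

Let c_linear k a b : c (k *: a + b) = k *: c a + c b.
Proof. by apply: (can_inj fK); rewrite f_linear !cK. Qed.

Let f0 : f 0 = 0.
Proof. by apply: (addrI (f 0)); rewrite -{1}[f 0]scale1r -f_linear scaler0 !addr0. Qed.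

Let c0 : c 0 = 0.
Proof. by rewrite -f0 fK. Qed.

Let fD u w : f (u + w) = f u + f w.
Proof. by rewrite -[u]scale1r f_linear !scale1r. Qed.

Let fZ k u : f (k *: u) = k *: f u.
Proof. by rewrite -[k *: u]addr0 f_linear f0 addr0. Qed.

Let f_sum u : f u = \sum_i u 0 i *: f (delta_mx 0 i).
Proof.
rewrite {1}(row_sum_delta u) (big_morph f fD f0).
by apply: eq_bigr => i _; exact: fZ.
Qed.

(** Matrices act on row vectors from the right, so [lmul_mx] reverses products. *)
Definition lmul_mx a : 'M[R[i]]_n := \matrix_i c (amul a (f (delta_mx 0 i))).

Lemma lmul_mxE a u : u *m lmul_mx a = c (amul a (f u)).
Proof.
rewrite mulmx_sum_row f_sum amul_sumr; apply: (can_inj fK); rewrite cK.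
rewrite (big_morph f fD f0); apply: eq_bigr => i _.
by rewrite fZ rowK cK amulZr.
Qed.

Lemma lmul_mx_linear k a b : lmul_mx (k *: a + b) = k *: lmul_mx a + lmul_mx b.
Proof.
apply/row_matrixP => i; rewrite linearP /= !rowK amulDl amulZl.
exact: c_linear.
Qed.

Lemma lmul_mxM a b : lmul_mx (amul a b) = lmul_mx b *m lmul_mx a.
Proof.
by apply/row_matrixP => i; rewrite row_mul !rowK lmul_mxE cK amulA.
Qed.

Definition ltrace a : R[i] := \tr (lmul_mx a).

Lemma ltrace_linear k a b : ltrace (k *: a + b) = k * ltrace a + ltrace b.
Proof. by rewrite /ltrace lmul_mx_linear linearP. Qed.

Lemma ltraceC a b : ltrace (amul a b) = ltrace (amul b a).
Proof. by rewrite /ltrace !lmul_mxM mxtrace_mulC. Qed.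

Lemma ltraceD a b : ltrace (a + b) = ltrace a + ltrace b.
Proof. by rewrite -[a]scale1r ltrace_linear mul1r scale1r. Qed.

Lemma ltrace0 : ltrace 0 = 0.
Proof. by apply: (addrI (ltrace 0)); rewrite -ltraceD !addr0. Qed.

Lemma ltraceZ k a : ltrace (k *: a) = k * ltrace a.
Proof. by rewrite -[k *: a]addr0 ltrace_linear ltrace0 addr0. Qed.

Lemma lmul_eigenvector a z : eigenvalue (lmul_mx a) z ->
  exists2 x, x != 0 & amul a x = z *: x.
Proof.
move=> /eigenvalueP[v va v0]; exists (f v).
  by apply: contraNneq v0 => fv; rewrite -[v]fK fv c0.
by rewrite -fZ -va lmul_mxE cK.
Qed.

Lemma selfadj_eigenvalue_real h z : astar h = h -> eigenvalue (lmul_mx h) z ->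
  complex.Im z = 0.
Proof.
move=> hh /lmul_eigenvector[x x0 hx].
have xx0 : amul (astar x) x != 0 by apply: contra_neq x0 => /astar_amul_eq0.
have e1 : amul (astar x) (amul h x) = z *: amul (astar x) x by rewrite hx amulZr.
have : z *: amul (astar x) x = z^* *: amul (astar x) x.
  have : astar (amul (astar x) (amul h x)) = amul (astar x) (amul h x).
    by rewrite !astarM astarK hh amulA.
  by rewrite e1 astarZ astarM astarK.
move=> /eqP; rewrite -subr_eq0 -scalerBl scaler_eq0 (negPf xx0) orbF subr_eq0.
by case: z {hx e1} => x1 y1 /eqP[] /= y1E; lra.
Qed.

(** An eigenvalue lies in the spectrum: a left inverse of [(- h, z)] in the unitization, applied to
    an eigenvector [x], would give [x = 0]. *)
Lemma positive_eigenvalue_ge0 h z : positive h -> eigenvalue (lmul_mx h) z ->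
  0 <= z.
Proof.
move=> [_ hpos] /lmul_eigenvector[x x0 hx]; apply: hpos => -[[b k] [_]].
rewrite /unitization_mul /= => -[E1 E2].
have : amul (amul b (- h) + k *: (- h) + z *: b) x = 0 by rewrite E1 amul0l.
rewrite !amulDl !amulZl -amulA -[- h]scaleN1r !amulZl !amulZr hx amulZr.
rewrite scaleN1r [- _ + _]addrC addrAC.
rewrite addrK scaleN1r scalerN scalerA E2 scale1r => /eqP; rewrite oppr_eq0.
exact/negP.
Qed.

Lemma eigenvalue_rnorm_le a z : eigenvalue (lmul_mx a) z -> rnorm z <= rnorm a.
Proof.
move=> /lmul_eigenvector[x x0 ax]; rewrite -(ler_pM2r (rnorm_gt0 x0)) -rnormZ -ax.
exact: ler_rnorm_amul.
Qed.

Lemma ltrace_rnorm_le a : rnorm (ltrace a) <= n%:R * rnorm a.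
Proof.
have [P [T [Pu PM trig]]] := trig_form (lmul_mx a).
rewrite /ltrace (mxtrace_sim Pu PM); apply: le_trans (ler_rnorm_sum _ _) _.
rewrite mulr_natl -[n in leRHS]card_ord -sumr_const; apply: ler_sum => i _.
exact: eigenvalue_rnorm_le (trig_eigenvalue _ Pu PM trig).
Qed.

(** [d] lists the eigenvalues of left multiplication by [h], read off the diagonal of a triangular
    form. If they all vanish the form is nilpotent, and selfadjointness makes it zero. *)
Lemma selfadj_ltrace h : astar h = h -> exists d : 'I_n -> R,
  [/\ ltrace h = (\sum_i d i)%:C%C, ltrace (amul h h) = (\sum_i d i ^+ 2)%:C%C,
    positive h -> forall i, 0 <= d i & (forall i, d i = 0) -> h = 0].
Proof.
move=> hh; have [P [T [Pu PM trig]]] := trig_form (lmul_mx h).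
have ev i := trig_eigenvalue i Pu PM trig.
pose d i := complex.Re (T i i).
have TE i : T i i = (d i)%:C%C.
  have := selfadj_eigenvalue_real hh (ev i); rewrite /d.
  by case: (T i i) => p q /= ->.
exists d; split.
- rewrite /ltrace (mxtrace_sim Pu PM) rmorph_sum; apply: eq_bigr => i _; exact: TE.
- rewrite /ltrace lmul_mxM (@mxtrace_sim _ _ _ (T *m T) P) //; last first.
    by rewrite mulmxA PM -mulmxA PM mulmxA.
  by rewrite mxtrace_trig_sqr // rmorph_sum; apply: eq_bigr => i _; rewrite TE -rmorphXn.
- by move=> hp i; have := positive_eigenvalue_ge0 hp (ev i); rewrite TE ler0c.
(* [T] is strictly lower triangular; if its rows before [i] vanish then row [i]
   is killed by [T], hence zero because [h (h x) = 0] implies [h x = 0]. *)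
move=> dd0; have T0 i : row i T = 0.
  elim/ltn_ind: {i}(i : nat) {-2}i (erefl (i : nat)) => m IH i im.
  have TT0 : row i T *m T = 0.
    rewrite mulmx_sum_row big1 // => j _; rewrite mxE.
    have [ji|] := ltnP j i; first by rewrite (IH j) ?scaler0 // -im.
    rewrite leq_eqVlt => /predU1P[/val_inj<-|ij]; first by rewrite TE dd0 scale0r.
    by rewrite (is_trig_mxP trig) // scale0r.
  pose w := row i P.
  have wM : w *m lmul_mx h = row i T *m P by rewrite /w -!row_mul PM.
  have hw : amul h (f w) = 0.
    apply: astar_amul_eq0; rewrite astarM hh -amulA.
    have -> : amul h (amul h (f w)) = 0; last by rewrite amul0r.
    apply: (can_inj cK); rewrite c0 -[amul h (f w)]cK -!lmul_mxE wM.
    by rewrite -mulmxA PM mulmxA TT0 mul0mx.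
  by rewrite -[row i T](mulmxK Pu) -wM lmul_mxE hw c0 mul0mx.
have {}T0 : T = 0 by apply/row_matrixP => i; rewrite T0 row0.
apply: selfadj_sqr_eq0 => //; apply: (can_inj cK).
have M0 : lmul_mx h = 0 by rewrite -[lmul_mx h](mulKmx Pu) PM T0 mul0mx mulmx0.
by rewrite -{2}[h]cK -lmul_mxE M0 mulmx0 c0.
Qed.

Lemma ltrace_sqr_ge0 h : astar h = h -> 0 <= complex.Re (ltrace (amul h h)).
Proof.
move=> /selfadj_ltrace[d [_ -> _ _]] /=; apply: sumr_ge0 => i _; exact: sqr_ge0.
Qed.

Lemma ltrace_sqr_eq0 h : astar h = h -> ltrace (amul h h) = 0 -> h = 0.
Proof.
move=> /selfadj_ltrace[d [_ -> _ h0]] [] /eqP.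
rewrite psumr_eq0 => [/allP d0|i _]; last exact: sqr_ge0.
apply: h0 => i; apply/eqP; rewrite -sqrf_eq0; exact: d0 (mem_index_enum i).
Qed.

Lemma selfadj_ltrace_Im h : astar h = h -> complex.Im (ltrace h) = 0.
Proof. by move=> /selfadj_ltrace[d [-> _ _ _]]. Qed.

Lemma Re_ltrace_astar a : complex.Re (ltrace (astar a)) = complex.Re (ltrace a).
Proof.
pose k := 'i%C *: (a - astar a).
have kk : astar k = k.
  rewrite /k astarZ astarB astarK -[a - _]opprB scalerN -scaleNr.
  by congr (_ *: _); rewrite conjCi.
have := selfadj_ltrace_Im kk; rewrite /k ltraceZ ltraceD -scaleN1r ltraceZ.
case: (ltrace a) => p q; case: (ltrace (astar a)) => p' q' /=; lra.
Qed.

(** On selfadjoint elements the trace of [h k] is real, being half the trace of the selfadjoint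
    [h k + k h]; so it is a positive real form. *)
Lemma ltrace_cauchy_schwarz h k : astar h = h -> astar k = k ->
  rnorm (ltrace (amul h k)) ^+ 2 <=
  complex.Re (ltrace (amul h h)) * complex.Re (ltrace (amul k k)).
Proof.
move=> hh kk.
have real : complex.Im (ltrace (amul h k)) = 0.
  have : astar (amul h k + amul k h) = amul h k + amul k h.
    by rewrite astarD !astarM hh kk addrC.
  move=> /selfadj_ltrace_Im; rewrite ltraceD (ltraceC k h).
  by case: (ltrace _) => p q /=; lra.
have tE : ltrace (amul h k) = (complex.Re (ltrace (amul h k)))%:C%C.
  by move: real; case: (ltrace _) => p q /= ->.
rewrite tE rnorm_real real_normK ?num_real //.
apply: discr_le => [|t]; first exact: ltrace_sqr_ge0.
have : astar (h + t%:C%C *: k) = h + t%:C%C *: k.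
  by rewrite astarD astarZ hh kk; congr (_ + _ *: _); exact: conjc_real.
move=> /ltrace_sqr_ge0; rewrite !(amulDl, amulDr, amulZl, amulZr, ltraceD, ltraceZ).
rewrite (ltraceC k h) tE.
case: (ltrace (amul h h)) => p1 q1; case: (ltrace (amul k k)) => p2 q2 /=.
by congr (_ <= _); ring.
Qed.

Lemma positive_ltrace h : positive h ->
  0 <= complex.Re (ltrace h) /\
  complex.Re (ltrace (amul h h)) <= complex.Re (ltrace h) ^+ 2.
Proof.
move=> hp; have [d [-> -> /(_ hp) d0 _]] := selfadj_ltrace hp.1.
split=> /=; first by apply: sumr_ge0.
rewrite expr2 mulr_suml; apply: ler_sum => i _.
rewrite expr2 ler_wpM2l // (bigD1 i) //= lerDl; exact: sumr_ge0.
Qed.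

(** For selfadjoint [b] combine Cauchy-Schwarz with the bound of the trace of [h h] by the squared
    trace of [h]. In general split [b] into selfadjoint parts [k1] and [k2]. *)
Lemma positive_ltrace_mul (b : A) : exists2 B : R, 0 <= B &
  forall h, positive h ->
  rnorm (ltrace (amul h b)) <= B * complex.Re (ltrace h).
Proof.
have sa (k : A) : astar k = k -> forall h, positive h ->
    rnorm (ltrace (amul h k)) <=
    Num.sqrt (complex.Re (ltrace (amul k k))) * complex.Re (ltrace h).
  move=> kk h hp; have [h0 h2] := positive_ltrace hp.
  rewrite -(@ler_pXn2r _ 2) ?nnegrE ?rnorm_ge0 ?mulr_ge0 ?sqrtr_ge0 //.
  apply: le_trans (ltrace_cauchy_schwarz hp.1 kk) _.
  rewrite exprMn sqr_sqrtr ?ltrace_sqr_ge0 // mulrC.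
  by rewrite ler_wpM2l ?ltrace_sqr_ge0.
pose k1 := b + astar b; pose k2 := 'i%C *: (b - astar b).
have k1s : astar k1 = k1 by rewrite /k1 astarD astarK addrC.
have k2s : astar k2 = k2.
  rewrite /k2 astarZ astarB astarK -[b - _]opprB scalerN -scaleNr.
  by congr (_ *: _); rewrite conjCi.
have bE : b = 2^-1 *: k1 + (- 'i%C / 2) *: k2.
  rewrite /k2 scalerA mulrAC mulNr -expr2 sqr_i opprK mul1r -scalerDr /k1.
  by rewrite addrACA subrr addr0 -mulr2n -[b *+ 2]scaler_nat scalerA mulVf ?scale1r // pnatr_eq0.
clearbody k1 k2.
exists (rnorm (2^-1 : R[i]) * Num.sqrt (complex.Re (ltrace (amul k1 k1))) +
  rnorm (- 'i%C / 2 : R[i]) * Num.sqrt (complex.Re (ltrace (amul k2 k2)))).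
  by rewrite addr_ge0 // mulr_ge0 ?rnorm_ge0 ?sqrtr_ge0.
move=> h hp; rewrite {1}bE amulDr !amulZr ltraceD !ltraceZ.
apply: le_trans (ler_rnormD _ _) _; rewrite (rnormM 2^-1) (rnormM (_ / 2)) mulrDl -!(mulrA (rnorm _)).
by apply: lerD; apply: ler_wpM2l; rewrite ?rnorm_ge0 // sa.
Qed.

(** The Gram matrix [G] of the trace form is invertible, so the coordinates of [b] are recovered
    from the traces of the [b e_j]. *)
Lemma ltrace_norm_le : exists2 B : R, 0 <= B & forall b,
  rnorm b <= B * \sum_j rnorm (ltrace (amul b (f (delta_mx 0 j)))).
Proof.
pose e j := f (delta_mx 0 j).
pose G := \matrix_(i, j) ltrace (amul (e i) (e j)).
have uG u j : (u *m G) 0 j = ltrace (amul (f u) (e j)).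
  rewrite mxE f_sum amul_suml (big_morph ltrace ltraceD ltrace0).
  by apply: eq_bigr => i _; rewrite mxE amulZl ltraceZ.
have Gu : G \in unitmx.
  rewrite -row_free_unit; apply: inj_row_free => u uG0.
  have tr0 a : ltrace (amul (f u) a) = 0.
    rewrite -[a]cK (f_sum (c a)) amul_sumr (big_morph ltrace ltraceD ltrace0) big1 // => j _.
    by rewrite amulZr ltraceZ -uG uG0 mxE mulr0.
  (* With [y = f u], nondegeneracy comes from testing [y] against [y^* y y^*]: the trace of the
     square of [y y^*] vanishes. *)
  have : amul (f u) (astar (f u)) = 0.
    apply: ltrace_sqr_eq0; first by rewrite astarM astarK.
    by rewrite -amulA tr0.
  rewrite -{1}[f u]astarK => /astar_amul_eq0 fu0.
  by rewrite -[u]fK -[f u]astarK fu0 astar0 c0.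
exists (\sum_i \sum_j rnorm (invmx G j i) * rnorm (e i)).
  by do 2!(apply: sumr_ge0 => ? _); rewrite mulr_ge0 ?rnorm_ge0.
move=> b; rewrite -{1}[b]cK f_sum mulr_suml.
apply: le_trans (ler_rnorm_sum _ _) _; apply: ler_sum => i _.
rewrite rnormZ -[c b](mulmxK Gu) mxE mulr_suml.
apply: le_trans (ler_wpM2r (rnorm_ge0 _) (ler_rnorm_sum _ _)) _.
rewrite mulr_suml; apply: ler_sum => j _.
rewrite rnormM uG cK -[leLHS]mulrA [leLHS]mulrC; apply: ler_wpM2l.
  by rewrite mulr_ge0 ?rnorm_ge0.
by rewrite (bigD1 j) //= lerDl sumr_ge0 // => k _; exact: rnorm_ge0.
Qed.

Lemma positive_rnorm_le_ltrace : exists B : R, forall h, positive h ->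
  rnorm h <= B * complex.Re (ltrace h).
Proof.
have [B B0 hB] := ltrace_norm_le.
have /choice[D DP] : forall j, exists D : R, forall h, positive h ->
    rnorm (ltrace (amul h (f (delta_mx 0 j)))) <= D * complex.Re (ltrace h).
  by move=> j; have [D _ hD] := positive_ltrace_mul (f (delta_mx 0 j)); exists D.
exists (B * \sum_j D j) => h hp; apply: le_trans (hB h) _.
rewrite -mulrA; apply: ler_wpM2l => //; rewrite mulr_suml; apply: ler_sum => j _; exact: DP.
Qed.

End Trace.

(** * Restriction of scalars to the reals *)

Section Realification.
Variables (R : realType) (V : lmodType R[i]).

Definition realified : Type := V.

HB.instance Definition _ := GRing.Zmodule.on realified.

Let scale (a : R) (v : realified) : realified := (a%:C%C *: (v : V) : V).

Let scaleA a b v : scale a (scale b v) = scale (a * b) v.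
Proof. by rewrite /scale scalerA -rmorphM. Qed.

Let scale1 v : scale 1 v = v.
Proof. exact: (scale1r (v : V)). Qed.

Let scaleDr : right_distributive scale +%R.
Proof. by move=> a u v; exact: scalerDr. Qed.

Let scaleDl v a b : scale (a + b) v = scale a v + scale b v.
Proof. by rewrite /scale rmorphD; exact: scalerDl. Qed.

HB.instance Definition _ :=
  GRing.Zmodule_isLmodule.Build R realified scaleA scale1 scaleDr scaleDl.

Lemma realified_scaleE (a : R) (v : realified) : a *: v = (a%:C%C *: (v : V) : V).
Proof. by []. Qed.

End Realification.

(** * Finite dimension implies condition [H] *)

Section BackwardDirection.
Variables (R : realType) (A : cstarAlgType R) (M : hilbertModType A).

Lemma finite_dimensional_condition_H : finite_dimensional A -> condition_H M.
Proof.
move=> /finite_dimensional_basis[n [f [c [flin fK cK]]]] x /hnorm_boundedP[B xB].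
pose tau := ltrace f c; pose V := realified M.
pose r (u v : V) : R := complex.Re (tau (inner (u : M) (v : M))).
have r_linear a (u v w : V) : r (a *: u + v) w = a * r u w + r v w.
  rewrite /r realified_scaleE inner_linear /tau (ltrace_linear flin fK cK).
  by case: (ltrace _ _ _) => p q; case: (ltrace _ _ _) => p' q' /=; lra.
have r_sym u v : r u v = r v u.
  by rewrite /r -(inner_star v u) /tau (Re_ltrace_astar flin fK cK).
have pos (u : M) : positive (inner u u : A) by exact: inner_ge0.
have r_ge0 (u : V) : 0 <= r u u by exact: (positive_ltrace flin fK cK (pos u)).1.
have [K hK] := positive_rnorm_le_ltrace flin fK cK.
(* [r z z] and the squared module norm bound each other up to the constants [K] and [n], so
   completeness carries over. *)
have r_complete (z : nat -> V) : (forall e : R, 0 < e -> exists N, forall m k,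
      (N <= m)%N -> (N <= k)%N -> r (z m - z k) (z m - z k) < e) ->
    exists l, (fun m => r (z m - l) (z m - l)) @ \oo --> (0 : R).
  move=> zC; have [e e0|l hl] := @hnorm_complete R A M z.
    have eE : e = (complex.Re e)%:C%C by rewrite RRe_real // gtr0_real.
    have e0' : 0 < complex.Re e by rewrite -ltcR -eE.
    pose K1 := `|K| + 1; have K0 : 0 < K1 by rewrite ltr_wpDl.
    have [|N hN] := zC (complex.Re e ^+ 2 / K1); first by rewrite divr_gt0 ?exprn_gt0.
    exists N => m k Nm Nk; rewrite eE hnormE ltcR.
    rewrite -(ger0_norm (sqrtr_ge0 _)); apply: ltr_norm_sqr => //.
    rewrite sqr_sqrtr ?rnorm_ge0 //; apply: le_lt_trans (hK _ (pos _)) _.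
    have := hN m k Nm Nk; rewrite ltr_pdivlMr // mulrC; apply: le_lt_trans.
    apply: ler_wpM2r; first exact: r_ge0.
    by rewrite (le_trans (ler_norm K)) // lerDl.
  exists l; apply/cvg0_seqP => [m|e e0]; first exact: r_ge0.
  (* Adding 1 keeps the divisor positive even when [n = 0]. *)
  pose D := n%:R + 1 : R; have D0 : 0 < D by rewrite ltr_wpDl.
  have [|N hN] := hl (Num.sqrt (e / D))%:C%C; first by rewrite ltcR sqrtr_gt0 divr_gt0.
  exists N => m /hN; rewrite hnormE ltcR ltr_sqrt ?divr_gt0 // ltr_pdivlMr // => hm.
  apply: le_lt_trans hm; apply: le_trans (ler_norm _) _.
  apply: le_trans (ler_Re_rnorm _) _.
  apply: le_trans (ltrace_rnorm_le flin fK cK _) _; rewrite mulrC.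
  by apply: ler_wpM2l; rewrite ?rnorm_ge0 // lerDl.
have [|phi [x0 [hphi hx0]]] := @bounded_weakly_cvg_subseq R V r r_linear r_sym r_ge0
    r_complete x (n%:R * B).
  move=> m; apply: le_trans (ler_norm _) _; apply: le_trans (ler_Re_rnorm _) _.
  apply: le_trans (ltrace_rnorm_le flin fK cK _) _; exact: ler_wpM2l.
have rsub y : (fun k => `|r (x (phi k) - x0 : M) y|) @ \oo --> (0 : R).
  have /cvg_seqP h := hx0 y; apply/cvg_seqP => e /h[N hN]; exists N => k /hN.
  rewrite subr0 normr_id; congr (_ < _); congr `|_|.
  rewrite /r inner_subl /tau [inner _ _ - _]addrC -[- inner _ _]scaleN1r (ltrace_linear flin fK cK).
  by case: (ltrace _ _ _) => p q; case: (ltrace _ _ _) => p' q' /=; lra.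
exists phi, x0; split=> // y; apply/cvg_rnormP.
have [C C0 hC] := ltrace_norm_le flin fK cK.
pose e j := f (delta_mx 0 j).
(* The trace of [<x,y> e_j] is that of [<x, e_j^* y>]. Pairing with [Y j] gives its real part and
   pairing with [Y' j] its imaginary part, as the second argument is conjugate-linear. *)
pose Y j : V := act (astar (e j)) y.
pose Y' j : V := 'i%C *: (Y j : M).
apply: (@cvg0_le _ _ (fun k => C * \sum_j (`|r (x (phi k) - x0 : M) (Y j)| +
  `|r (x (phi k) - x0 : M) (Y' j)|))); last first.
  by apply: cvg0Ml; apply: cvg0_sum => j; exact: cvg0D.
move=> k; rewrite rnorm_ge0 /= -inner_subl.
apply: le_trans (hC _) _; apply: ler_wpM2l => //; apply: ler_sum => j _.
have iY : inner (x (phi k) - x0) (Y j : M) = amul (inner (x (phi k) - x0) y) (e j) :> A.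
  by rewrite inner_actr astarK.
have -> : r (x (phi k) - x0 : M) (Y' j) =
    complex.Im (tau (amul (inner (x (phi k) - x0) y) (e j))).
  rewrite /r /Y' inner_scaler iY /tau (ltraceZ flin fK cK).
  have -> : ('i%C : R[i])^* = - 'i%C by exact: conjCi.
  by case: (ltrace _ _ _) => p q /=; lra.
rewrite /r iY; exact: ler_rnorm_ReIm.
Qed.

End BackwardDirection.

Theorem theorem2p5 (R : realType) (A : cstarAlgType R) (M : hilbertModType A)
    (hfull : full M) :
  condition_H M <-> finite_dimensional A.
Proof.
split; first exact: condition_H_finite_dimensional.
exact: finite_dimensional_condition_H.
Qed.
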